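(* Let $\mathcal{C}_w$ be the class of weak closures of all OTG's with $n\geq 5$ vertices. Then $\mathcal{C}_w=\varphi_1\,\dot\cup\,\varphi_2\,\dot\cup\,\varphi_3$ (a disjoint union), and for every $G_w\in\mathcal{C}_w$ with $n$ vertices: (1) $h(G_w)=n-2$ if and only if $G_w\in\varphi_1$; (2) $h(G_w)=\tfrac{n}{2}$ if and only if $G_w\in\varphi_2$; (3) $h(G_w)=n$ if and only if $G_w\in\varphi_3$.
   Context: All graphs are finite and simple; graphs are considered up to isomorphism. A graph $G$ with $n$ vertices is an OTG if $d(u)+d(v)\geq n$ for every pair of distinct nonadjacent vertices $u,v$. For $X\subseteq V(G)$, an $X$-cycle is a cycle containing all vertices of $X$. For a Hamiltonian graph $G$, a nonempty $X\subseteq V(G)$ is an $H$-force set if every $X$-cycle is Hamiltonian; $h(G)$ is the smallest cardinality of an $H$-force set. The weak closure of an OTG $G$ on $n$ vertices is obtained by repeatedly joining a pair of nonadjacent vertices whose degree sum (in the current graph) is at least $n+1$ until no such pair remains (well defined). $A\vee B$ denotes the join of disjoint graphs $A,B$ (all edges between them added), $A+B$ the disjoint union, $K_k$ the complete graph, $K_k^c$ the edgeless graph on $k$ vertices, $K_{k,k}$ the complete bipartite graph. For $n$ vertices define: $\varphi_1=\{K_2\vee(K_m+K_{n-m-2}) : 1\le m<\tfrac n2\}$; for $n$ even, $G_{21}=K^c_{n/2}\vee K_{n/2}$, $G_{12}=K_2\vee(K_{n/2-1}+K_{n/2-1})$, and $\varphi_2=\{G_{21},K_{n/2,n/2}\}$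 (empty if $n$ is odd); $\varphi_3$ is the set consisting of all graphs $Z\vee K_m$ with $n$ even, $0\le m<\tfrac n2$, $Z$ a graph on $n-m$ vertices such that every vertex of $Z$ has degree exactly $\tfrac n2$ in $Z\vee K_m$ (for $m=0$ this is just $Z$), excluding $G_{12}$ and $K_{n/2,n/2}$, together with the complete graph $K_n$. *)

(* Defs.v *)
From mathcomp Require Import all_boot.
Set Implicit Arguments.
Unset Strict Implicit.
Unset Printing Implicit Defensive.

Record sgraph (V : finType) := SGraph {
  adj : rel V;
  adj_sym : symmetric adj;
  adj_irr : irreflexive adj
}.

Definition deg (V : finType) (G : sgraph V) (u : V) : nat :=
  #|[set v | adj G u v]|.

Definition giso (V W : finType) (G : sgraph V) (H : sgraph W) : Prop :=
  exists2 f : V -> W, bijective f & forall x y, adj G x y = adj H (f x) (f y).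

Definition complete_adj k : rel 'I_k := fun i j => i != j.
Lemma complete_sym k : symmetric (@complete_adj k).
Proof. by move=> i j; rewrite /complete_adj eq_sym. Qed.
Lemma complete_irr k : irreflexive (@complete_adj k).
Proof. by move=> i; rewrite /complete_adj eqxx. Qed.
Definition complete k : sgraph 'I_k := SGraph (@complete_sym k) (@complete_irr k).

Definition edgeless_adj k : rel 'I_k := fun _ _ => false.
Lemma edgeless_sym k : symmetric (@edgeless_adj k).
Proof. by []. Qed.
Lemma edgeless_irr k : irreflexive (@edgeless_adj k).
Proof. by []. Qed.
Definition edgeless k : sgraph 'I_k := SGraph (@edgeless_sym k) (@edgeless_irr k).

Section SumGraphs.
Variables (V W : finType) (G : sgraph V) (H : sgraph W).

(* [b] tells whether a vertex of [G] and a vertex of [H] are adjacent. *)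
Definition sum_adj (b : bool) : rel (V + W)%type := fun x y =>
  match x, y with
  | inl u, inl v => adj G u v
  | inr u, inr v => adj H u v
  | _, _ => b
  end.
Lemma sum_sym b : symmetric (sum_adj b).
Proof. by move=> [u|u] [v|v] //=; rewrite adj_sym. Qed.
Lemma sum_irr b : irreflexive (sum_adj b).
Proof. by move=> [u|u] /=; rewrite adj_irr. Qed.

Definition gjoin : sgraph (V + W)%type := SGraph (sum_sym true) (sum_irr true).
Definition gunion : sgraph (V + W)%type := SGraph (sum_sym false) (sum_irr false).
End SumGraphs.

Definition complete_bipartite p q := gjoin (edgeless p) (edgeless q).

Definition is_cycle (V : finType) (G : sgraph V) (c : seq V) : Prop :=
  ucycle (adj G) c /\ 2 < size c.

Definition ham_cycle (V : finType) (G : sgraph V) (c : seq V) : Prop :=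
  is_cycle G c /\ forall v, v \in c.

Definition hamiltonian (V : finType) (G : sgraph V) : Prop :=
  exists c, ham_cycle G c.

Definition X_cycle (V : finType) (G : sgraph V) (X : {set V}) (c : seq V) : Prop :=
  is_cycle G c /\ {subset X <= c}.

Definition hforce_set (V : finType) (G : sgraph V) (X : {set V}) : Prop :=
  X != set0 /\ forall c, X_cycle G X c -> ham_cycle G c.

(* The partial function h as a relation: [hforce_number G k] says that G is
   Hamiltonian, i.e. h(G) is defined, and that h(G) = k. *)
Definition hforce_number (V : finType) (G : sgraph V) (k : nat) : Prop :=
  [/\ hamiltonian G,
      exists2 X, hforce_set G X & #|X| = k
    & forall X, hforce_set G X -> k <= #|X|].

Definition OTG (V : finType) (G : sgraph V) : Prop :=
  forall u v, u != v -> ~~ adj G u v -> #|V| <= deg G u + deg G v.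

Definition weak_joinable (V : finType) (G : sgraph V) (u v : V) : Prop :=
  [/\ u != v, ~~ adj G u v & #|V| + 1 <= deg G u + deg G v].

Definition weak_step (V : finType) (G G' : sgraph V) : Prop :=
  exists u v, weak_joinable G u v /\
    forall x y, adj G' x y =
      [|| adj G x y, (x == u) && (y == v) | (x == v) && (y == u)].

Inductive weak_steps (V : finType) (G : sgraph V) : sgraph V -> Prop :=
| weak_steps0 : weak_steps G G
| weak_stepsS G' G'' : weak_steps G G' -> weak_step G' G'' -> weak_steps G G''.

Definition weak_closure (V : finType) (G Gw : sgraph V) : Prop :=
  weak_steps G Gw /\ forall u v, ~ weak_joinable Gw u v.

(* The members on n vertices of the class C_w. A weak closure has the
   vertex set of the original graph, and the predicate is invariant under
   [giso], so H may be taken on V itself. *)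
Definition Cw (n : nat) (V : finType) (G : sgraph V) : Prop :=
  #|V| = n /\ exists2 H : sgraph V, OTG H & weak_closure H G.

Definition phi1 (n : nat) (V : finType) (G : sgraph V) : Prop :=
  exists m, [/\ 1 <= m, 2 * m < n
    & giso G (gjoin (complete 2) (gunion (complete m) (complete (n - m - 2))))].

Definition G21 n := gjoin (edgeless n./2) (complete n./2).

Definition G12 n :=
  gjoin (complete 2) (gunion (complete (n./2 - 1)) (complete (n./2 - 1))).

Definition phi2 (n : nat) (V : finType) (G : sgraph V) : Prop :=
  ~~ odd n /\ (giso G (G21 n) \/ giso G (complete_bipartite n./2 n./2)).

Definition phi3 (n : nat) (V : finType) (G : sgraph V) : Prop :=
  [/\ ~~ odd n,
      exists (m : nat) (Z : sgraph 'I_(n - m)),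
        [/\ 2 * m < n,
            forall z, deg (gjoin Z (complete m)) (inl z) = n./2
          & giso G (gjoin Z (complete m))],
      ~ giso G (G12 n)
    & ~ giso G (complete_bipartite n./2 n./2)]
  \/ giso G (complete n).

(* Main.v *)
(* A weak closure G is exactly a graph in which d(u) + d(v) = n for all
   nonadjacent u, v.  If some vertex has degree < n/2, the vertices of degree
   < n/2 and those of degree > n/2 form two cliques covering G, and counting the
   edges between them forces K_2 v (K_m + K_(n-m-2)); otherwise every
   non-universal vertex has degree n/2.

   For the H-force number, the point is that G - v is Hamiltonian for every v
   when all degrees of G (of order n = 2k) are at least k, except when G has an
   independent set of size k or two disjoint nonadjacent sets of size k - 1; the
   hypotheses of phi_3 turn these exceptions into K_(k,k) and G_12.  Dirac's
   theorem for G yields a Hamiltonian path x ... y of G - v.  If G - v has no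
   Hamiltonian cycle then, for consecutive a, b on the path, exactly one of
   x ~ b and y ~ a holds.  If x is adjacent to b but not to a, for some a off the
   start, then rerouting gives a cycle of G - v missing only a; the neighbours of
   a alternate along it, and its non-neighbours form an independent set of size
   k.  Otherwise the neighbours of x form an initial segment of the path,
   which rotations of that segment turn into a clique cut off by one vertex. *)

Require Import Defs.
From Stdlib Require Import Classical.
From mathcomp Require Import all_boot zify.
Set Implicit Arguments.
Unset Strict Implicit.
Unset Printing Implicit Defensive.

(** * Hamiltonian cycles *)

Section Cycles.
Variables (V : finType) (G : sgraph V).
Notation E := (adj G).
Notation spans_cycle s := (exists2 c, perm_eq c s & cycle E c).

Lemma spans_cycleP s :
  spans_cycle s \/ (forall c, perm_eq c s -> ~~ cycle E c).
Proof.
case h: (has (cycle E) (permutations s)); [left|right].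
  by case/hasP: h => c; rewrite mem_permutations => cs ?; exists c.
move=> c cs; apply/negP => Ec; move/negP: h; apply; apply/hasP.
by exists c; rewrite // mem_permutations.
Qed.

Lemma next_cat (T : eqType) (a b : seq T) x y :
  uniq (a ++ x :: y :: b) -> next (a ++ x :: y :: b) x = y.
Proof.
move=> Us; rewrite -(next_rot (size a) Us) rot_size_cat /=.
by rewrite eqxx.
Qed.

Lemma next_last (T : eqType) (x : T) p : uniq (x :: p) -> next (x :: p) (last x p) = x.
Proof.
case/lastP: p => [|p y]; first by rewrite /= eqxx.
rewrite last_rcons -cats1 -cat_cons => Us.
by rewrite -(next_rot (size (x :: p)) Us) rot_size_cat /= eqxx.
Qed.

Lemma cat_next (T : eqType) (x a : T) p :
  uniq (x :: p) -> a \in x :: p -> a != last x p ->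
  exists s t, x :: p = s ++ a :: next (x :: p) a :: t.
Proof.
move=> Us as_; have <- : last x (x :: p) = last x p by [].
move: (x :: p) as_ Us => q /splitPr[s [|b t]] Us; first by rewrite last_cat eqxx.
by move=> _; exists s, t; rewrite next_cat.
Qed.

(** The second path is traversed backwards: along [x :: a], across to the end of [z :: b], down to
    [z] and back to [x]. The crossing arguments below all have this shape. *)
Lemma cross_cycle x a z b : path E x a -> path E z b ->
  E x z -> E (last x a) (last z b) -> cycle E (x :: a ++ rev (z :: b)).
Proof.
move=> Pa Pb xz ab /=.
rewrite rcons_cat cat_path Pa rcons_path rev_cons last_rcons [E z x]adj_sym xz andbT.
rewrite -rev_cons lastI rev_rcons /= ab rev_path.
by rewrite (eq_path (e' := E)) // => u v; rewrite adj_sym.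
Qed.

(** If some [a] has y ~ a and x ~ next a, these two edges replace the one leaving [a] and close a
    cycle. Otherwise the predecessors of neighbours of [x] and the neighbours of [y] are disjoint
    sets in [s] minus [y]; counting gives the strict bound, and in the extremal case they form a
    partition. *)
Lemma ends_crossing x p (s := x :: p) (y := last x p) :
    uniq s -> path E x p ->
  spans_cycle s \/
  (#|[set u in s | E x u]| + #|[set u in s | E y u]| < size s /\
   ((#|[set u in s | E x u]| + #|[set u in s | E y u]|).+1 = size s ->
    forall a, a \in s -> a != y -> E x (next s a) = ~~ E y a)).
Proof.
move=> Us Ep.
set Sx := [set u in s | E x u]; set Sy := [set u in s | E y u].
pose S := [set prev s u | u in Sx].
have cS : #|S| = #|Sx| by apply/card_imset/(can_inj (next_prev Us)).
have cs : #|[set u in s]| = size s by rewrite cardsE; apply/card_uniqP.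
have inS a : (a \in S) = (a \in s) && E x (next s a).
  apply/imsetP/andP => [[u]|[as_ xa]].
    by rewrite inE => /andP[us xu] ->; rewrite mem_prev next_prev.
  by exists (next s a); rewrite ?prev_next // inE mem_next as_.
have ys : y \in s by apply: mem_last.
(* [next] is cyclic: the successor of [y] is [x], which is not adjacent to itself. *)
have yS : y \notin S by rewrite inS next_last // adj_irr andbF.
have yT : y \notin Sy by rewrite inE adj_irr andbF.
have sub : S :|: Sy \subset [set u in s] :\ y.
  apply/subsetP => a; rewrite in_setU in_setD1 !in_set => ha.
  apply/andP; split; last by case/orP: ha => [|/andP[]//]; rewrite inS => /andP[].
  by apply: contraTneq ha => ->; rewrite negb_or yS; move: yT; rewrite in_set.
have csy : #|[set u in s] :\ y|.+1 = size s.
  by rewrite -cs [in RHS](cardsD1 y) inE ys.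
case: (boolP [disjoint S & Sy]) => [dis|/pred0Pn[a /= /andP[]]]; [right|move=> aS aSy; left].
  have cU : #|S :|: Sy| = #|Sx| + #|Sy|.
    by rewrite cardsU disjoint_setI0 // cards0 subn0 cS.
  split; first by rewrite -cU -csy ltnS subset_leq_card.
  move=> eqs a as_ ay.
  have /setP/(_ a) : S :|: Sy = [set u in s] :\ y.
    by apply/eqP; rewrite eqEcard sub -ltnS csy cU eqs leqnn.
  rewrite in_setU in_setD1 !in_set inS as_ ay /=.
  case: (boolP (E y a)) => [ya _|_]; last by rewrite orbF.
  apply/negP => xa; move/pred0P/(_ a): dis => /=.
  by rewrite inS in_set as_ xa ya.
move: aS aSy; rewrite inS in_set => /andP[as_ xa] /andP[_ ya].
have ay : a != y by apply: contraTneq ya => ->; rewrite adj_irr.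
have [q [t est]] := cat_next Us as_ ay.
move: xa est; rewrite -/s; move: (next s a) => b xa est.
(* If [a] is the first vertex, the edge from [y] to [x] closes the path itself. *)
case: q est => [|x' q] [xE pE].
  have yx : E y x by rewrite xE.
  by exists s; rewrite // /s /= rcons_path Ep.
subst x'; exists (x :: rcons q a ++ rev (b :: t)).
  by rewrite /s pE perm_cons -cats1 -catA perm_cat2l perm_cons perm_rev.
move: Ep; rewrite pE cat_path => /= /and4P[Pq qa _ Pt].
apply: cross_cycle => //; first by rewrite rcons_path Pq.
rewrite last_rcons adj_sym; suff <- : y = last b t by [].
by rewrite /y pE last_cat.
Qed.

(** An end with a neighbour off the path extends it. Otherwise both ends have all their neighbours
    on the path, and [ends_crossing] makes it a cycle; a vertex [u] off this cycle has a neighbour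
    [z] on it, and opening the cycle at [z] gives a longer path from [u]. *)
Lemma longer_path x p : uniq (x :: p) -> path E x p -> #|V| <= 2 * deg G x ->
    #|V| <= 2 * deg G (last x p) ->
    (forall u, u \notin x :: p -> #|V| <= 2 * deg G u) ->
  (exists2 c, perm_eq c (enum V) & cycle E c) \/
  (exists z q, [/\ uniq (z :: q), path E z q & size q = (size p).+1]).
Proof.
move=> Us Ep dx dy du.
have sizeE : (forall u, u \in x :: p) -> perm_eq (x :: p) (enum V).
  move=> all_s; apply: uniq_perm; rewrite ?enum_uniq // => u.
  by rewrite all_s mem_enum.
case: (boolP [exists u, (u \notin x :: p) && E x u]) => [/existsP[u /andP[us xu]]|].
  by right; exists u, (x :: p); split; rewrite //= ?us // adj_sym xu.
rewrite negb_exists => /forallP nx.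
case: (boolP [exists u, (u \notin x :: p) && E (last x p) u]).
  case/existsP => u /andP[us yu]; right; exists x, (rcons p u).
  by rewrite -rcons_cons rcons_uniq us Us rcons_path Ep yu size_rcons.
rewrite negb_exists => /forallP ny.
have in_s w : (forall u, ~~ ((u \notin x :: p) && E w u)) ->
    #|[set u in x :: p | E w u]| = deg G w.
  move=> nw; apply: eq_card => u; rewrite !in_set.
  by have := nw u; case: (u \in _); case: (E w u).
have le_s : size (x :: p) <= #|V| by rewrite -(card_uniqP Us) max_card.
have [[c cs Ec]|[]] := ends_crossing Us Ep; last first.
  by rewrite !in_s // => lt_s; lia.
case: (boolP [forall u, u \in x :: p]) => [/forallP all_s|].
  by left; exists c => //; apply: perm_trans cs (sizeE all_s).
rewrite negb_forall => /existsP[u us]; right.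
have xu : x != u by apply: contraNneq us => <-; rewrite inE eqxx.
have nxu : ~~ E x u by have := nx u; rewrite us.
(* x and u are nonadjacent with large degree sum, so they share a neighbour, which is on the cycle. *)
have [z /andP[xz uz]] : exists z, E x z && E u z.
  apply/existsP; apply: contraT; rewrite negb_exists => /forallP none.
  have dis : [disjoint [set v | E x v] & [set v | E u v]].
    apply/pred0P => v /=; rewrite !inE; exact: negbTE (none v).
  have sub : [set v | E x v] :|: [set v | E u v] \subset ~: [set x; u].
    apply/subsetP => v; rewrite !inE => xuv; rewrite negb_or.
    apply/andP; split; apply: contraTneq xuv => ->; rewrite adj_irr ?orbF //.
    by rewrite adj_sym.
  have := subset_leq_card sub; rewrite cardsU disjoint_setI0 // cards0 subn0.
  rewrite -/(deg G x) -/(deg G u); have := cardsC [set x; u]; rewrite cards2 xu.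
  have := du u us; clear -dx; lia.
have zs : z \in x :: p by have := nx z; rewrite xz andbT negbK.
have zc : z \in c by rewrite (perm_mem cs).
have [i q rc] := rot_to zc.
have Uq : uniq (z :: q) by rewrite -rc rot_uniq (perm_uniq cs).
have Eq : cycle E (z :: q) by rewrite -rc rot_cycle.
exists u, (z :: q); split.
- by rewrite cons_uniq Uq andbT -rc mem_rot (perm_mem cs).
- by rewrite /= uz; move: Eq; rewrite /= rcons_path => /andP[].
- by rewrite -rc size_rot (perm_size cs).
Qed.

Lemma dirac : 0 < #|V| -> (forall u, #|V| <= 2 * deg G u) ->
  exists2 c, perm_eq c (enum V) & cycle E c.
Proof.
move=> /card_gt0P[x0 _] du.
(* [m] is fuel, spent by one at each extension; it cannot run out, since no path has more than
   [#|V|] vertices. *)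
suff loop m x p : uniq (x :: p) -> path E x p -> #|V| < size p + m ->
    exists2 c, perm_eq c (enum V) & cycle E c.
  by apply: (loop #|V|.+1 x0 [::]); rewrite //= add0n.
elim: m x p => [|m IH] x p Us Ep lt_m.
  have : size (x :: p) <= #|V| by rewrite -(card_uniqP Us) max_card.
  by move: lt_m; rewrite addn0 => /ltn_trans lt_m /lt_m; rewrite ltnn.
have [//|[z [q [Uq Eq sq]]]] := longer_path Us Ep (du _) (du _) (fun u _ => du u).
by apply: (IH z q) => //; rewrite sq; lia.
Qed.

End Cycles.

(** * Cycles avoiding one vertex *)

Section NearHamiltonian.
Variables (V : finType) (G : sgraph V) (k : nat) (v : V).
Notation E := (adj G).
Hypothesis k_gt2 : 2 < k.
Hypothesis cardV : #|V| = 2 * k.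
Hypothesis min_deg : forall u, k <= deg G u.
Hypothesis no_cycle :
  forall c, uniq c -> (forall u, (u \in c) = (u != v)) -> ~~ cycle E c.

Section SwapVertex.
Variables (c : seq V) (w : V).
Hypothesis Uc : uniq c.
Hypothesis Ec : cycle E c.
Hypothesis wv : w != v.
Hypothesis mem_c : forall u, (u \in c) = (u != v) && (u != w).

(** Otherwise [w] fits into [c] between [y] and its successor, giving a cycle through all vertices
    but [v]. *)
Lemma no_consecutive_neighbours y : y \in c -> E w y -> ~~ E w (next c y).
Proof.
move=> yc wy; apply/negP => wn.
have nc : next c y \in c by rewrite mem_next.
have [i p rc] := rot_to nc.
have Up : uniq (next c y :: p) by rewrite -rc rot_uniq.
have last_y : last (next c y) p = y.
  by apply: (can_inj (prev_next Uc)); rewrite -(next_rot i Uc) rc next_last.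
have := no_cycle (c := w :: next c y :: p); rewrite cons_uniq Up -rc mem_rot.
rewrite mem_c eqxx andbF andbT => /(_ isT); case/(_ _)/negP.
  move=> u; rewrite inE mem_rot mem_c; case: eqP => [->|_]; first by rewrite wv.
  by rewrite andbT.
have := Ec; rewrite -(rot_cycle i) rc /= !rcons_path last_y => /andP[-> _].
by rewrite wn adj_sym wy.
Qed.

(** The neighbours of [w] on [c] and their successors are disjoint among 2k - 2 vertices, so there
    are at most k - 1 such neighbours. Since [v] is the only other possible neighbour of [w], there
    are at least k - 1. Hence the two sets partition [c]. *)
Lemma alternating_neighbours :
  #|[set y in c | E w y]| = k.-1 /\
  forall y, y \in c -> E w (next c y) = ~~ E w y.
Proof.
set S := [set y in c | E w y].
pose T := [set next c y | y in S].
have cT : #|T| = #|S| by apply/card_imset/(can_inj (prev_next Uc)).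
have cc : #|[set y in c]| = (2 * k).-2.
  have <- : ~: [set v; w] = [set y in c].
    by apply/setP => u; rewrite !inE negb_or mem_c.
  by have := cardsC [set v; w]; rewrite cards2 eq_sym wv cardV; lia.
have dis : [disjoint S & T].
  apply/pred0P => y /=; apply/negP => /andP[]; rewrite in_set => /andP[_ wy].
  case/imsetP => x; rewrite in_set => /andP[xc wx] yx.
  by have := no_consecutive_neighbours xc wx; rewrite -yx wy.
have sub : S :|: T \subset [set y in c].
  apply/subsetP => y; rewrite in_setU in_set => /orP[|/imsetP[x]].
    by rewrite in_set => /andP[].
  by rewrite in_set => /andP[xc _] ->; rewrite mem_next.
have cU : #|S :|: T| = 2 * #|S|.
  by rewrite cardsU disjoint_setI0 // cards0 subn0 cT mul2n addnn.
have dS : deg G w <= #|S|.+1.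
  have : [set y | E w y] \subset v |: S.
    apply/subsetP => y; rewrite !inE mem_c => wy; rewrite wy.
    case: eqP => //= _; rewrite andbT.
    by apply: contraTneq wy => ->; rewrite adj_irr.
  move/subset_leq_card/leq_trans; apply.
  by rewrite cardsU1; case: (v \notin S).
have := subset_leq_card sub; rewrite cU cc => leU; have := leq_trans (min_deg w) dS => dw.
split=> [|y yc]; first by lia.
have /setP/(_ (next c y)) : S :|: T = [set y in c].
  by apply/eqP; rewrite eqEcard sub cU cc; lia.
rewrite in_setU !in_set mem_next yc /=.
rewrite /T (mem_imset _ _ (can_inj (prev_next Uc))) in_set yc /=.
case: (boolP (E w y)) => [wy _|_]; last by rewrite orbF.
exact/negbTE/no_consecutive_neighbours.
Qed.

End SwapVertex.

(** The start vertices may differ, because the two cycles compared below share only the tail [p]. *)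
Lemma alternating_agree (f g : pred V) x x' p : f x = g x' ->
  path (fun a b => f b == ~~ f a) x p -> path (fun a b => g b == ~~ g a) x' p ->
  {in p, f =1 g}.
Proof.
elim: p x x' => //= y p IH x x' fg /andP[/eqP fy fp] /andP[/eqP gy gp] z.
have fgy : f y = g y by rewrite fy gy fg.
by rewrite inE => /predU1P[->//|]; apply: IH fp gp z.
Qed.

(** A non-neighbour [z] of [w] on [c] lies between two neighbours of [w], so [z] and [w] can be
    exchanged. Comparing the two alternations, [z] has the same neighbours on [c] as [w]. So [w] and
    its k - 1 non-neighbours on [c] are independent. *)
Lemma independent_of_almost_cycle c w : uniq c -> cycle E c -> w != v ->
    (forall u, (u \in c) = (u != v) && (u != w)) ->
  exists I : {set V}, [/\ #|I| = k, v \notin I & {in I &, forall x y, ~~ E x y}].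
Proof.
move=> Uc Ec wv mem_c.
have [cS alt] := alternating_neighbours Uc Ec wv mem_c.
(* Swapping z for w in c gives an almost-cycle missing z; both alternate on the common part. *)
have twin z y : z \in c -> ~~ E w z -> y \in c -> E z y = E w y.
  move=> zc wz yc; have [i p rc] := rot_to zc.
  have Up : uniq (z :: p) by rewrite -rc rot_uniq.
  have mem_p u : (u \in p) = [&& u != v, u != w & u != z].
    have := mem_c u; rewrite -(mem_rot i) rc inE.
    case: (u =P z) Up => [->|_ _ /= ->]; last by rewrite andbT.
    by rewrite /= !andbF => /andP[/negbTE].
  have wp : w \notin p by rewrite mem_p eqxx andbF.
  have alt_zp : cycle (fun a b => E w b == ~~ E w a) (z :: p).
    rewrite -rc rot_cycle; apply: cycle_from_next => // u uc.
    by rewrite alt.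
  have Uwp : uniq (w :: p) by move: Up; rewrite /= wp => /andP[].
  have Ezp : cycle E (z :: p) by rewrite -rc rot_cycle.
  have alt_p := alt_zp; move: alt_p; rewrite /= rcons_path => /andP[alt_p /eqP alt_last].
  have wl : E w (last z p) by move: alt_last; rewrite (negbTE wz); case: (E w _).
  have zv : z != v by move: zc; rewrite mem_c => /andP[].
  have zw : z != w by move: zc; rewrite mem_c => /andP[].
  have Ewp : cycle E (w :: p).
    case: (p) Ezp wl alt_p => [|h t] /=; first by rewrite (negbTE wz).
    rewrite !rcons_path (negbTE wz) adj_sym => /and3P[_ -> _] wl /andP[/eqP-> _].
    by rewrite adj_sym wl.
  have [_ altz] : #|[set y in w :: p | E z y]| = k.-1 /\
      forall y, y \in w :: p -> E z (next (w :: p) y) = ~~ E z y.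
    apply: alternating_neighbours => // u; rewrite inE mem_p.
    by case: (u =P w) => [->|] //=; rewrite wv eq_sym zw.
  have : cycle (fun a b => E z b == ~~ E z a) (w :: p).
    by apply: cycle_from_next => // u uc; rewrite altz.
  rewrite /= rcons_path => /andP[alt_p' _].
  have agree := alternating_agree (f := E w) (g := E z) _ alt_p alt_p'.
  move: yc; rewrite -(mem_rot i) rc inE => /predU1P[->|yp].
    by rewrite adj_irr (negbTE wz).
  by rewrite -agree // (negbTE wz) adj_sym (negbTE wz).
pose S := [set y in c | E w y].
have mem_I u : (u \in ~: (v |: S)) = (u != v) && ~~ E w u.
  rewrite !inE negb_or mem_c; case: (u =P v) => //= _.
  by case: (u =P w) => [->|]; rewrite ?adj_irr.
exists (~: (v |: S)); split.
- have := cardsC (v |: S); rewrite cardV cardsU1 cS in_set mem_c eqxx /=.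
  by move: k_gt2; lia.
- by rewrite mem_I eqxx.
move=> x y; rewrite !mem_I => /andP[xv wx] /andP[yv wy].
case: (x =P w) => [->//|/eqP xw].
case: (y =P w) => [->|/eqP yw]; first by rewrite adj_sym.
by rewrite twin // mem_c ?xv ?yv.
Qed.

Lemma first_jump (T : Type) (P : pred T) h t : ~~ P h -> has P t ->
  exists b1 a b b2, [/\ h :: t = b1 ++ a :: b :: b2, ~~ P a & P b].
Proof.
elim: t h => //= b t IH h nh; case: (boolP (P b)) => [Pb _|nb /(IH _ nb)].
  by exists [::], h, b, t.
by case=> b1 [a [b' [b2 [-> na Pb']]]]; exists (h :: b1), a, b', b2.
Qed.

Lemma vertex_deletion :
  (exists2 I : {set V}, #|I| = k & {in I &, forall x y, ~~ E x y}) \/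
  (exists A B : {set V}, [/\ [disjoint A & B], #|A| = k.-1, #|B| = k.-1
     & {in A & B, forall x y, ~~ E x y}]).
Proof.
have [c0 c0V Ec0] : exists2 c, perm_eq c (enum V) & cycle E c.
  by apply: dirac; [|move=> u; have := min_deg u]; rewrite cardV; move: k_gt2; lia.
have vc : v \in c0 by rewrite (perm_mem c0V) mem_enum.
have [i s rc] := rot_to vc.
have : uniq (v :: s) by rewrite -rc rot_uniq (perm_uniq c0V) enum_uniq.
rewrite cons_uniq => /andP[vs Us].
have mem_s u : (u \in s) = (u != v).
  have : u \in v :: s by rewrite -rc mem_rot (perm_mem c0V) mem_enum.
  by rewrite inE; case: eqP => [->|] //=; rewrite (negbTE vs).
have Es : cycle E (v :: s) by rewrite -rc rot_cycle.
have size_s : (size s).+1 = 2 * k.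
  by rewrite -[_.+1]/(size (v :: s)) -rc size_rot (perm_size c0V) -cardE.
case: s vs Us mem_s Es size_s {rc} => [|x p] vs Us mem_s Es size_s.
  by move: size_s k_gt2 => /=; lia.
have Ep : path E x p by move: Es; rewrite /= rcons_path => /and3P[].
have deg_s u : deg G u <= #|[set w in x :: p | E u w]|.+1.
  have : [set w | E u w] \subset v |: [set w in x :: p | E u w].
    by apply/subsetP => w; rewrite !in_set mem_s in_set1 => ->; case: eqP.
  by move/subset_leq_card/leq_trans; apply; rewrite cardsU1; case: (_ \notin _).
set y := last x p.
have no_span cy : perm_eq cy (x :: p) -> ~~ cycle E cy.
  move=> cs; apply: no_cycle => [|u]; first by rewrite (perm_uniq cs).
  by rewrite (perm_mem cs).
(* The path has 2k - 1 vertices and each end has at least k - 1 neighbours on it, so the bound of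
   [ends_crossing] is attained. *)
have flip s1 a b s2 : x :: p = s1 ++ a :: b :: s2 -> E x b = ~~ E y a.
  move=> es; have [[cy cs Ecy]|[lt_s eq_s]] := ends_crossing Us Ep.
    by have := no_span cy cs; rewrite Ecy.
  have ab : next (x :: p) a = b by rewrite es next_cat // -es.
  rewrite -ab eq_s //.
  - have := leq_trans (min_deg x) (deg_s x); have := leq_trans (min_deg y) (deg_s y).
    move: lt_s size_s; rewrite -/y; lia.
  - by rewrite es mem_cat mem_head orbT.
  have -> : last x p = last b s2 by rewrite -[last x p]/(last x (x :: p)) es last_cat.
  move: Us; rewrite es cat_uniq => /and3P[_ _ /= /andP[ab' _]].
  by apply: contraNneq ab' => ->; apply: mem_last.
have nxy : ~~ E x y.
  have := no_span _ (perm_refl _); rewrite /= rcons_path Ep /= -/y adj_sym; exact.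
have yp : y \in p.
  rewrite /y; case: (p) size_s => [|z t] /=; last by rewrite mem_last.
  by move: k_gt2; lia.
(* [a] is the longest run of neighbours of [x] at the start of [p]. *)
have [a [b [pE all_a nh]]] : exists a b,
    [/\ p = a ++ b, all (E x) a & ~~ E x (head x b)].
  elim: (p) => [|z q [a [b [-> all_a nh]]]].
    by exists [::], [::]; rewrite /= adj_irr.
  case: (boolP (E x z)) => xz; last by exists [::], (z :: a ++ b).
  by exists (z :: a), b; rewrite /= xz.
case: b pE nh => [|h t] pE nh.
  by move: yp; rewrite pE cats0 => /(allP all_a); rewrite (negbTE nxy).
have y_last : y = last h t by rewrite /y pE last_cat.
(* A neighbour of [x] beyond [h] yields consecutive [w], [b] with only [b] adjacent to [x]. By
   [flip], [y] is adjacent to the predecessor of [w]; going from [x] to that predecessor, then from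
   [y] back to [b], gives a cycle missing only [w] and [v]. *)
case: (boolP (has (E x) t)) => [/(first_jump nh)[b1 [w [b [b2 [tE xw xb]]]]]|nt].
  left.
  have sE : x :: p = (x :: a ++ b1) ++ w :: b :: b2 by rewrite pE tE /= -catA.
  have pW : perm_eq (x :: p) (w :: (x :: a ++ b1) ++ b :: b2).
    by rewrite sE -[w :: b :: b2]cat1s perm_catCA.
  have uW : w \notin (x :: a ++ b1) ++ b :: b2.
    by move: Us; rewrite (perm_uniq pW) cons_uniq => /andP[].
  have yb2 : y = last b b2 by rewrite /y -[last x p]/(last x (x :: p)) sE last_cat.
  have ya : E (last x (a ++ b1)) y.
    have := flip (belast x (a ++ b1)) (last x (a ++ b1)) w (b :: b2).
    rewrite -cat_rcons -lastI => /(_ sE); rewrite (negbTE xw) adj_sym.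
    by move/esym/negbFE.
  move: Ep; have -> : p = (a ++ b1) ++ w :: b :: b2 by case: sE.
  rewrite cat_path /= => /and4P[Pab _ _ Pb].
  have cW : perm_eq (x :: (a ++ b1) ++ rev (b :: b2)) ((x :: a ++ b1) ++ b :: b2).
    by rewrite perm_cons perm_cat2l perm_rev.
  have wv : w != v by rewrite -mem_s sE mem_cat mem_head orbT.
  have [I [cI _ iI]] : exists I : {set V},
      [/\ #|I| = k, v \notin I & {in I &, forall x y, ~~ E x y}].
    apply: (independent_of_almost_cycle (c := x :: (a ++ b1) ++ rev (b :: b2)) (w := w)).
    - by rewrite (perm_uniq cW); move: Us; rewrite (perm_uniq pW) cons_uniq => /andP[].
    - by apply: cross_cycle; rewrite // -yb2.
    - by [].
    move=> u; rewrite (perm_mem cW) -mem_s (perm_mem pW) [in RHS]inE.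
    by case: eqP => [->|] /=; rewrite ?(negbTE uW) ?andbT.
  by exists I.
right.
have xt u : u \in h :: t -> ~~ E x u.
  by rewrite inE => /predU1P[->//|ut]; apply: contraNN nt => xu; apply/hasP; exists u.
(* Reversing the path up to z makes z an endpoint, so an edge z b would close a cycle. *)
have no_edge z b : z \in belast x a -> b \in h :: t -> ~~ E z b.
  move=> za bt; apply/negP => zb.
  have [a1 [h1 [c1 aE]]] : exists a1 h1 c1, x :: a = a1 ++ z :: h1 :: c1.
    case/splitPr: za (lastI x a) => a1 c ->; rewrite rcons_cat /=.
    by case: c => [|h1 c1]; [exists a1, (last x a), [::] | exists a1, h1, (rcons c1 (last x a))].
  have [b1 [b2 tE]] : exists b1 b2, h :: t = b1 ++ b :: b2.
    by case/splitPr: bt => b1 b2; exists b1, b2.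
  have xh1 : E x h1.
    apply: (allP all_a); case: a1 aE => [|x' a1] [_ ->]; first by rewrite inE eqxx.
    by rewrite mem_cat !inE eqxx !orbT.
  have sE : x :: p = a1 ++ z :: h1 :: c1 ++ b1 ++ b :: b2.
    by rewrite pE tE -cat_cons aE -!catA.
  (* [l] precedes [b] on the path, so [flip] makes it adjacent to [y]. The cycle is z ... x, h1 ...
     l, y ... b and back to z. *)
  pose l := last h1 (c1 ++ b1).
  have yl : E y l.
    have := flip (a1 ++ z :: belast h1 (c1 ++ b1)) l b b2.
    rewrite -cat_rcons rcons_cat rcons_cons -lastI -catA /= -catA => /(_ sE).
    by rewrite (negbTE (xt b bt)) => /esym/negbFE.
  have Ps : sorted E (a1 ++ z :: h1 :: c1 ++ b1 ++ b :: b2) by rewrite -sE.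
  have Pz : path E z (rev a1 ++ h1 :: c1 ++ b1) /\ path E b b2.
    case: a1 aE Ps {sE} => [|x' a1] [<- _] /=.
      by rewrite catA cat_path /= => /and3P[-> -> /andP[_ ->]].
    rewrite cat_path /= catA cat_path /= => /and5P[Pa1 a1z _ Pc /andP[_ ->]].
    split => //; rewrite cat_path /= rev_cons last_rcons xh1 Pc !andbT -rev_cons.
    rewrite -{1}(last_rcons x a1 z) -(belast_rcons x a1 z) rev_path.
    rewrite (eq_path (e' := E)) => [|u u']; last by rewrite adj_sym.
    by rewrite rcons_path Pa1.
  have [Pz1 Pb] := Pz.
  have := no_span (z :: (rev a1 ++ h1 :: c1 ++ b1) ++ rev (b :: b2)).
  rewrite cross_cycle //; last first.
    have -> : last b b2 = y.
      by rewrite /y -[last x p]/(last x (x :: p)) sE -!cat_cons !catA last_cat.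
    by rewrite last_cat /= adj_sym.
  case/(_ _)/negP => //; apply/permP => P.
  rewrite sE /= !count_cat !count_rev /= !count_cat /=; clear -P; lia.
(* The last vertex of [x :: a] is the cut vertex and belongs to neither side. On the path, the
   neighbours of [x] lie in [a], and those of [y] in [h :: t] minus [y] or at the cut vertex. So
   each side has at least k - 1 of the 2k - 2 vertices, hence exactly k - 1. *)
exists [set z in belast x a], [set z in h :: t].
have sE : x :: p = belast x a ++ last x a :: h :: t by rewrite -cat_rcons -lastI pE.
have Ub : uniq (belast x a) /\ uniq (h :: t).
  by move: Us; rewrite sE cat_uniq /= => /and3P[-> _ /and3P[_ -> ->]].
have [Ua Ut] := Ub.
have sa : #|[set z in belast x a]| = size a.
  by rewrite cardsE (card_uniqP Ua) size_belast.
have st : #|[set z in h :: t]| = size (h :: t).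
  by rewrite cardsE (card_uniqP Ut).
have mem_p u : (u \in x :: p) = [|| u \in belast x a, u == last x a | u \in h :: t].
  by rewrite sE mem_cat inE.
have dx : k.-1 <= size a.
  have sub : [set w in x :: p | E x w] \subset [set w in a].
    apply/subsetP => w; rewrite !in_set pE -cat_cons mem_cat => /andP[].
    case/orP => [|/xt/negbTE->//]; rewrite inE => /predU1P[->|//].
    by rewrite adj_irr.
  rewrite -subn1 leq_subLR add1n (leq_trans (min_deg x)) // (leq_trans (deg_s x)) //.
  by rewrite ltnS (leq_trans (subset_leq_card sub)) // cardsE card_size.
have yt : y \in h :: t by rewrite y_last mem_last.
have dy : k.-1 <= size (h :: t).
  have sub : [set w in x :: p | E y w] \subset last x a |: ([set w in h :: t] :\ y).
    apply/subsetP => w; rewrite in_set mem_p => /andP[/or3P[wa|/eqP->|wt] yw].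
    - by have := no_edge w y wa yt; rewrite adj_sym yw.
    - by rewrite setU11.
    rewrite in_setU1 in_setD1 in_set wt andbT; apply/orP; right.
    by apply: contraTneq yw => ->; rewrite adj_irr.
  rewrite -subn1 leq_subLR add1n (leq_trans (min_deg y)) // (leq_trans (deg_s y)) //.
  rewrite ltnS (leq_trans (subset_leq_card sub)) // -[X in _ <= X]st.
  rewrite (cardsD1 y [set z in h :: t]) in_set yt cardsU1 leq_add2r.
  by case: (_ \notin _).
have sp : size p = size a + size (h :: t) by rewrite pE size_cat.
split.
- apply/pred0P => u /=; rewrite !in_set; apply/negP => /andP[ua ut].
  move: Us; rewrite sE cat_uniq => /and3P[_ /hasP[]]; exists u => //.
  by rewrite inE ut orbT.
- by move: size_s dx dy; rewrite sa /= sp /=; clear; lia.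
- by move: size_s dx dy; rewrite st /= sp /=; clear; lia.
- by move=> z b; rewrite !in_set => za /(no_edge z b za).
Qed.

End NearHamiltonian.

(** * Isomorphisms and the three families *)

(** In each colour, the i-th vertex of [V] is matched with the i-th vertex of [W]. *)
Lemma color_bij (V W T : finType) (f : V -> T) (g : W -> T) :
    (forall t, #|[set x | f x == t]| = #|[set y | g y == t]|) ->
  exists2 h : V -> W, bijective h & forall x, g (h x) = f x.
Proof.
move=> eq_fg.
have cardVW : #|V| = #|W|.
  rewrite -!sum1_card (partition_big f xpredT) //= (partition_big g xpredT) //=.
  by apply: eq_bigr => t _; rewrite !sum1dep_card; apply: eq_fg.
(* An empty [V] is treated apart, as it leaves no default value for [nth]. *)
case: (pickP (mem V)) => [x0 _|V0]; last first.
  have W0 : #|W| = 0 by rewrite -cardVW; apply: eq_card0.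
  have noV (x : V) : False by have := V0 x.
  exists (fun x => False_rect W (noV x)); last by move=> x; case: (noV x).
  by apply: inj_card_bij; [move=> x; case: (noV x) | rewrite W0].
have /card_gt0P[y0 _] : 0 < #|W| by rewrite -cardVW; apply/card_gt0P; exists x0.
pose cf t := enum [set x | f x == t]; pose cg t := enum [set y | g y == t].
have size_fg t : size (cf t) = size (cg t) by rewrite -!cardE eq_fg.
pose h x := nth y0 (cg (f x)) (index x (cf (f x))).
have mem_cf x : x \in cf (f x) by rewrite mem_enum inE.
have h_lt x : index x (cf (f x)) < size (cg (f x)) by rewrite -size_fg index_mem.
have gh x : g (h x) = f x.
  by have := mem_nth y0 (h_lt x); rewrite mem_enum inE => /eqP.
exists h => //; apply: inj_card_bij; last by rewrite cardVW.
move=> x y hxy; have fxy : f x = f y by rewrite -!gh hxy.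
move/eqP: hxy; rewrite /h -fxy nth_uniq ?enum_uniq ?h_lt //; last first.
  by rewrite fxy h_lt.
by move/eqP/index_inj; apply; rewrite ?mem_cf // fxy mem_cf.
Qed.

Section Isomorphism.
Variables (V W : finType) (G : sgraph V) (H : sgraph W).

(** A colour-preserving bijection is an isomorphism as soon as adjacency of distinct vertices
    depends only on their colours. *)
Lemma giso_blowup (T : finType) (M : rel T) (f : V -> T) (g : W -> T) :
    (forall x y, adj G x y = (x != y) && M (f x) (f y)) ->
    (forall x y, adj H x y = (x != y) && M (g x) (g y)) ->
    (forall t, #|[set x | f x == t]| = #|[set y | g y == t]|) ->
  giso G H.
Proof.
move=> adjG adjH /color_bij[h bij_h gh]; exists h => // x y.
by rewrite adjG adjH !gh (bij_eq bij_h).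
Qed.

Lemma giso_card : giso G H -> #|V| = #|W|.
Proof. by case=> f bij_f _; apply: bij_eq_card bij_f. Qed.

Lemma giso_deg f : bijective f -> (forall x y, adj G x y = adj H (f x) (f y)) ->
  forall x, deg G x = deg H (f x).
Proof.
move=> bij_f fE x; rewrite /deg -(on_card_preimset (f := f)); last first.
  exact: onW_bij.
by apply: eq_card => y; rewrite !inE fE.
Qed.

End Isomorphism.

Lemma card_bij_preim (V W : finType) (f : V -> W) (A : {set W}) :
  bijective f -> #|f @^-1: A| = #|A|.
Proof. by move=> bij_f; apply: on_card_preimset; apply: onW_bij. Qed.

Lemma card_sumset (V W : finType) (A : {set (V + W)%type}) :
  #|A| = #|[set x | inl x \in A]| + #|[set y | inr y \in A]|.
Proof.
have AE : A = (inl @: [set x | inl x \in A]) :|: (inr @: [set y | inr y \in A]).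
  apply/setP => -[x|y]; rewrite in_setU.
    rewrite (mem_imset _ _ inl_inj) inE; case: (_ \in A) => //=.
    by apply/esym/negbTE/imsetP => -[].
  rewrite (mem_imset _ _ inr_inj) inE; case: (_ \in A); rewrite ?orbT ?orbF //.
  by apply/esym/negbTE/imsetP => -[].
rewrite {1}AE cardsU disjoint_setI0; last first.
  by apply/pred0P => z /=; apply/negP => /andP[/imsetP[x _ ->] /imsetP[]].
by rewrite cards0 subn0 (card_imset _ inl_inj) (card_imset _ inr_inj).
Qed.

Lemma card_full (n : nat) (A : {set 'I_n}) : (forall x, x \in A) -> #|A| = n.
Proof.
by move=> allA; rewrite -[RHS]card_ord -cardsT; apply: eq_card => x; rewrite allA inE.
Qed.

(** The complement of a complete bipartite graph with parts [A] and [B], up to isolated vertices of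
    that graph. With exactly two vertices outside [A] and [B], both nonempty, it is K_2 v (K_p +
    K_q). *)
Definition two_cliques (V : finType) (G : sgraph V) (A B : {set V}) : Prop :=
  [disjoint A & B] /\ forall x y, adj G x y =
    (x != y) && ~~ ((x \in A) && (y \in B) || (x \in B) && (y \in A)).

(* Complete join of an independent set I with its complement, a clique if b and edgeless if not. *)
Definition set_join (b : bool) (V : finType) (G : sgraph V) (I : {set V}) : Prop :=
  forall x y, adj G x y =
    (x != y) && (if x \in I then y \notin I else (y \in I) || b).

Lemma two_cliques_giso (V W : finType) (G : sgraph V) (H : sgraph W) A B C D :
    two_cliques G A B -> two_cliques H C D -> #|V| = #|W| ->
    #|A| = #|C| -> #|B| = #|D| -> giso G H.
Proof.
move=> [disAB adjG] [disCD adjH] cVW cA cB.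
pose M (s t : bool * bool) := ~~ (s.1 && t.2 || s.2 && t.1).
apply: (giso_blowup (M := M) (f := fun x => (x \in A, x \in B))
          (g := fun y => (y \in C, y \in D))) => //.
have eqA (U : finType) (P Q : {set U}) : [disjoint P & Q] ->
    [/\ [set x | (x \in P, x \in Q) == (true, true)] = set0,
        [set x | (x \in P, x \in Q) == (true, false)] = P,
        [set x | (x \in P, x \in Q) == (false, true)] = Q
      & [set x | (x \in P, x \in Q) == (false, false)] = ~: (P :|: Q)].
  move=> dis; have nPQ x : (x \in P) && (x \in Q) = false by apply: (pred0P dis).
  by split; apply/setP => x; rewrite !inE xpair_eqE; have := nPQ x;
     case: (x \in P); case: (x \in Q).
have [G1 G2 G3 G4] := eqA _ A B disAB; have [H1 H2 H3 H4] := eqA _ C D disCD.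
case=> -[] []; rewrite ?G1 ?G2 ?G3 ?G4 ?H1 ?H2 ?H3 ?H4 ?cards0 //.
rewrite -[LHS](addKn #|A :|: B|) cardsC cVW -(cardsC (C :|: D)).
by rewrite !cardsU !disjoint_setI0 // !cards0 !subn0 cA cB addKn.
Qed.

Lemma two_cliques_transport (V W : finType) (G : sgraph V) (H : sgraph W) C D :
    giso G H -> two_cliques H C D ->
  exists A B, [/\ two_cliques G A B, #|A| = #|C| & #|B| = #|D|].
Proof.
case=> f bij_f fE [dis adjH]; exists (f @^-1: C), (f @^-1: D).
split; rewrite ?card_bij_preim //; split.
  by apply/pred0P => x /=; rewrite !inE; apply: (pred0P dis).
by move=> x y; rewrite fE adjH !inE (bij_eq bij_f).
Qed.

Lemma two_cliques_std m p : exists A B,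
  [/\ two_cliques (gjoin (complete 2) (gunion (complete m) (complete p))) A B,
      #|A| = m & #|B| = p].
Proof.
exists [set x | if x is inr (inl _) then true else false],
       [set x | if x is inr (inr _) then true else false].
split.
- split; first by apply/pred0P => -[x|[x|x]]; rewrite /= !inE.
  move=> [x|[x|x]] [y|[y|y]]; rewrite !inE //= ?andbT ?andbF //.
- rewrite !card_sumset eq_card0 => [|x]; last by rewrite !inE.
  rewrite add0n card_full => [|x]; last by rewrite !inE.
  by rewrite eq_card0 ?addn0 // => x; rewrite !inE.
rewrite !card_sumset eq_card0 => [|x]; last by rewrite !inE.
rewrite add0n eq_card0 => [|x]; last by rewrite !inE.
by rewrite add0n card_full // => x; rewrite !inE.
Qed.

Lemma set_join_giso b (V W : finType) (G : sgraph V) (H : sgraph W) I J :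
    set_join b G I -> set_join b H J -> #|V| = #|W| -> #|I| = #|J| -> giso G H.
Proof.
move=> adjG adjH cVW cI.
pose M (s t : bool) := if s then ~~ t else t || b.
apply: (giso_blowup (M := M) (f := fun x => x \in I) (g := fun y => y \in J)) => //.
have eqT (U : finType) (P : {set U}) : [set x | (x \in P) == true] = P.
  by apply/setP => x; rewrite inE eqb_id.
have eqF (U : finType) (P : {set U}) : [set x | (x \in P) == false] = ~: P.
  by apply/setP => x; rewrite !inE eqbF_neg.
case; rewrite ?eqT ?eqF //.
by rewrite -[LHS](addKn #|I|) cardsC cVW -(cardsC J) cI addKn.
Qed.

Lemma set_join_transport b (V W : finType) (G : sgraph V) (H : sgraph W) J :
    giso G H -> set_join b H J -> exists2 I, set_join b G I & #|I| = #|J|.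
Proof.
case=> f bij_f fE adjH; exists (f @^-1: J); rewrite ?card_bij_preim //.
by move=> x y; rewrite fE adjH !inE (bij_eq bij_f).
Qed.

Lemma set_join_std p q :
  (exists2 I, set_join true (gjoin (edgeless p) (complete q)) I & #|I| = p) /\
  (exists2 I, set_join false (complete_bipartite p q) I & #|I| = p).
Proof.
pose I := [set x : 'I_p + 'I_q | if x is inl _ then true else false].
have cI : #|I| = p.
  rewrite card_sumset card_full => [|x]; last by rewrite !inE.
  by rewrite eq_card0 ?addn0 // => x; rewrite !inE.
by split; exists I => // -[x|x] [y|y]; rewrite !inE //= ?andbT ?andbF.
Qed.

(** Trades the isomorphism with a sum type for subsets of [V] itself, from which degrees and cycles
    can be read off. *)
Lemma phi1P n (V : finType) (G : sgraph V) : phi1 n G <->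
  (#|V| = n /\ exists A B, [/\ two_cliques G A B, 0 < #|A|,
     2 * #|A| < n & #|A| + #|B| + 2 = n]).
Proof.
have card_std m p : #|{: 'I_2 + ('I_m + 'I_p)}| = 2 + (m + p).
  by rewrite !card_sum !card_ord.
split=> [[m [m_gt0 lt_m iso]]|[cV [A [B [tc A_gt0 ltA sAB]]]]].
  have [A [B [tc cA cB]]] := two_cliques_std m (n - m - 2).
  have [A' [B' [tc' cA' cB']]] := two_cliques_transport iso tc.
  rewrite (giso_card iso) card_std; split; first by lia.
  by exists A', B'; rewrite cA' cB' cA cB; split=> //; lia.
exists #|A|; split=> //.
have [C [D [tc' cC cD]]] := two_cliques_std #|A| (n - #|A| - 2).
apply: two_cliques_giso tc tc' _ _ _; rewrite ?card_std ?cC ?cD //; lia.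
Qed.

(** The flag [b] is true for G_21 and false for the complete bipartite graph; the parity of [n] is
    carried by the size of [I]. *)
Lemma phi2P n (V : finType) (G : sgraph V) : phi2 n G <->
  #|V| = n /\ exists b I, set_join b G I /\ 2 * #|I| = n.
Proof.
have card_std p q : #|{: 'I_p + 'I_q}| = p + q by rewrite card_sum !card_ord.
have [[I1 join1 cI1] [I0 join0 cI0]] := set_join_std n./2 n./2.
split=> [[even_n iso]|[cV [b [I [joinI cI]]]]].
  have nE : n./2 + n./2 = n by rewrite addnn even_halfK.
  case: iso => iso; rewrite (giso_card iso) card_std; split=> //.
    by have [I joinI cI] := set_join_transport iso join1; exists true, I; split=> //; lia.
  by have [I joinI cI] := set_join_transport iso join0; exists false, I; split=> //; lia.
have even_n : ~~ odd n by rewrite -cI oddM.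
have nE : n./2 + n./2 = n by rewrite addnn even_halfK.
split=> //; case: b joinI => joinI; [left|right].
  by apply: set_join_giso joinI join1 _ _; rewrite ?card_std ?cI1 //; lia.
by apply: set_join_giso joinI join0 _ _; rewrite ?card_std ?cI0 //; lia.
Qed.

(** * H-force numbers *)

Section HForce.
Variables (V : finType) (G : sgraph V).
Notation E := (adj G).

Lemma hforce_number_inj k l : hforce_number G k -> hforce_number G l -> k = l.
Proof.
case=> _ [X hX <-] minX [_ [Y hY <-] minY].
by apply/eqP; rewrite eqn_leq minX // minY.
Qed.

Lemma clique_path x p : uniq (x :: p) ->
  {in x :: p &, forall u w, u != w -> E u w} -> path E x p.
Proof.
move=> Us cl; apply: (pairwise_sorted (s := x :: p)).
move: Us; rewrite uniq_pairwise; apply: (sub_in_pairwise (P := [in x :: p])) => //.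
Qed.

(** If [w] were outside [X], the cycle [c] would be a non-Hamiltonian X-cycle. This gives lower
    bounds for h. *)
Lemma hforce_mem X w c : hforce_set G X -> is_cycle G c ->
  (forall u, u != w -> u \in c) -> w \notin c -> w \in X.
Proof.
move=> [_ hX] cyc_c mem_c wc; apply: contraT => wX.
have [|_ /(_ w)] := hX c; last by rewrite (negbTE wc).
by split=> // u uX; apply: mem_c; apply: contraNneq wX => <-.
Qed.

Lemma hforce_number_full : 0 < #|V| -> hamiltonian G ->
    (forall w, exists2 c, is_cycle G c & forall u, (u \in c) = (u != w)) ->
  hforce_number G #|V|.
Proof.
move=> V_gt0 hamG del; split=> //.
  exists [set: V]; last by rewrite cardsT.
  split; first by rewrite -card_gt0 cardsT.
  by move=> c [cyc_c sub]; split=> // u; apply: sub; rewrite inE.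
move=> X hX; rewrite -cardsT; apply/subset_leq_card/subsetP => w _.
have [c cyc_c mem_c] := del w.
by apply: hforce_mem hX cyc_c _ _ => [u|]; rewrite mem_c ?eqxx.
Qed.

(** * H-force number of two cliques joined through two universal vertices *)

Section TwoCliques.
Variables A B : {set V}.
Hypothesis GAB : two_cliques G A B.
Hypothesis A_gt0 : 0 < #|A|.
Hypothesis B_gt0 : 0 < #|B|.
Hypothesis card_cut : #|A| + #|B| + 2 = #|V|.

(** The complements of [A] and of [B] are cliques: x, la, y runs in the one avoiding [B] and y, lb,
    x in the one avoiding [A]. *)
Lemma two_cliques_cycle la lb x y : uniq (x :: la ++ y :: lb) ->
    {subset la <= A} -> {subset lb <= B} -> x \notin A :|: B -> y \notin A :|: B ->
  cycle E (x :: la ++ y :: lb).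
Proof.
case: GAB => dis adjG Us sA sB.
rewrite !in_setU !negb_or => /andP[xA xB] /andP[yA yB].
have nAB u : u \in A -> (u \in B) = false.
  by move=> uA; apply: contraTF uA => uB; have := pred0P dis u; rewrite /= uB andbT => ->.
have nBA u : u \in B -> (u \in A) = false.
  by move=> uB; have := pred0P dis u; rewrite /= uB andbT.
rewrite /= rcons_cat rcons_cons cat_path.
have U1 : uniq (x :: rcons la y).
  by move: Us; rewrite -cat_rcons -cat_cons cat_uniq => /andP[].
have U2 : uniq (y :: rcons lb x).
  rewrite -rcons_cons rcons_uniq; move: Us; rewrite cons_uniq cat_uniq mem_cat negb_or.
  by case/and3P=> /andP[_ ->] _ /andP[_ ->].
have -> : path E x la && path E (last x la) (y :: rcons lb x) =
    path E x (rcons la y) && path E y (rcons lb x).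
  by rewrite rcons_path /= andbA.
apply/andP; split; apply: clique_path => // u w.
- have uA z : z \in x :: rcons la y -> z \notin B.
    rewrite inE mem_rcons inE => /or3P[/eqP->//|/eqP->//|/sA/nAB->//].
  move=> /uA uB /uA wB uw; rewrite adjG uw (negbTE uB) (negbTE wB).
  by rewrite andbF.
have uB z : z \in y :: rcons lb x -> z \notin A.
  rewrite inE mem_rcons inE => /or3P[/eqP->//|/eqP->//|/sB/nBA->//].
by move=> /uB uA /uB wA uw; rewrite adjG uw (negbTE uA) (negbTE wA) andbF.
Qed.

Lemma cut_pair : exists x y, [/\ x != y, x \notin A :|: B, y \notin A :|: B &
  forall u, u \notin A :|: B -> (u == x) || (u == y)].
Proof.
have : #|~: (A :|: B)| == 2.
  have := cardsC (A :|: B); rewrite cardsU disjoint_setI0; last by case: GAB.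
  by rewrite cards0 subn0 => cE; apply/eqP; move: card_cut; rewrite -cE; clear; lia.
move/cards2P=> [x [y [xy ABE]]]; exists x, y; split=> //.
- by rewrite -in_setC ABE !inE eqxx.
- by rewrite -in_setC ABE !inE eqxx orbT.
by move=> u; rewrite -in_setC ABE !inE.
Qed.

(** An empty [D] yields a Hamiltonian cycle; singletons yield the cycles for the lower bound on
    h. *)
Lemma two_cliques_omit (D : {set V}) : D \subset A :|: B ->
  exists2 c, cycle E c && uniq c & forall u, (u \in c) = (u \notin D).
Proof.
move=> sD; have [x [y [xy xAB yAB cut]]] := cut_pair.
have [dis _] := GAB.
pose la := enum (A :\: D); pose lb := enum (B :\: D).
have Us : uniq (x :: la ++ y :: lb).
  move: xAB yAB; rewrite !in_setU !negb_or => /andP[xA xB] /andP[yA yB].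
  rewrite cons_uniq cat_uniq cons_uniq !enum_uniq andbT /= mem_cat inE negb_or.
  rewrite !mem_enum !in_setD (negbTE xA) (negbTE xB) (negbTE yA) (negbTE yB).
  rewrite !andbF orbF xy /= andbT; apply/hasPn => u; rewrite !mem_enum !in_setD.
  by case/andP=> _ uB; have := pred0P dis u; rewrite /= uB andbT => ->; rewrite andbF.
exists (x :: la ++ y :: lb).
  rewrite Us andbT; apply: two_cliques_cycle => // u; rewrite mem_enum in_setD.
    by case/andP.
  by case/andP.
move=> u; rewrite inE mem_cat inE !mem_enum !in_setD.
case: (boolP (u \in A :|: B)) => [uAB|uAB].
  have /negbTE-> : u != x by apply: contraNneq xAB => <-.
  have /negbTE-> : u != y by apply: contraNneq yAB => <-.
  by rewrite /= -andb_orr -in_setU uAB andbT.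
have -> : u \notin D by apply: contraNN uAB; apply: (subsetP sD).
by case/orP: (cut u uAB) => ->; rewrite ?orbT.
Qed.

(** The two vertices outside [A] and [B] separate them. A cycle missing one of these, cut at the
    other, would be a path covering both cliques without leaving them, yet no edge joins [A] to
    [B]. *)
Lemma cycle_through_cliques c : is_cycle G c -> {subset A :|: B <= c} ->
  forall u, u \in c.
Proof.
move=> [/andP[Ec Uc] _] sc; have [dis adjG] := GAB.
have [a aA] : exists a, a \in A by apply/card_gt0P.
have [b bB] : exists b, b \in B by apply/card_gt0P.
have bA : b \notin A.
  by apply/negP => bA; have := pred0P dis b; rewrite /= bA bB.
have [x0 [y0 [_ x0AB y0AB cut]]] := cut_pair.
(* Cut c at the only other possible cut vertex z, if it lies on c. *)
suff no_path p : uniq p -> sorted E p -> {subset A :|: B <= p} -> {subset p <= A :|: B} -> False.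
  move=> u; apply: contraT => uc.
  have uAB : u \notin A :|: B by apply: contraNN uc; apply: sc.
  have [z zAB cutz] : exists2 z, z \notin A :|: B &
      forall w, w \notin A :|: B -> (w == u) || (w == z).
    case/orP: (cut u uAB) => /eqP->; first by exists y0.
    by exists x0 => // w /cut; rewrite orbC.
  case: (boolP (z \in c)) => zc.
    have [i p rc] := rot_to zc.
    have /andP[zp Up] : uniq (z :: p) by rewrite -rc rot_uniq.
    have mem_p w : w \in c -> w != z -> w \in p.
      by rewrite -(mem_rot i) rc inE => /predU1P[->|//]; rewrite eqxx.
    case: (no_path p) => //.
    - by move: Ec; rewrite -(rot_cycle i) rc /= rcons_path => /andP[/path_sorted].
    - by move=> w wAB; apply: mem_p (sc _ wAB) _; apply: contraNneq zAB => <-.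
    move=> w wp; apply: contraT => /cutz/orP[]/eqP wE.
      by move: uc; rewrite -wE -(mem_rot i) rc inE wp orbT.
    by move: zp; rewrite -wE wp.
  case: (no_path c) => //.
    by case: (c) Ec => //= h t; rewrite rcons_path => /andP[].
  move=> w wc; apply: contraT => /cutz/orP[]/eqP wE.
    by move: uc; rewrite -wE wc.
  by move: zc; rewrite -wE wc.
move=> Up Ep sp ps.
have side : sorted (fun u w => (u \in A) == (w \in A)) p.
  apply: (sub_in_sorted (P := [in A :|: B]) (e := E)) => //; last by apply/allP.
  move=> u w; rewrite !inE adjG.
  have := pred0P dis u; have := pred0P dis w => /=.
  by case: (u \in A); case: (u \in B); case: (w \in A); case: (w \in B); rewrite ?andbF.
case: p side sp {Up Ep ps} => [|h p] side sp.
  by have := sp a; rewrite inE aA => /(_ isT).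
have all_h : all (fun u => (h \in A) == (u \in A)) p.
  by apply: (order_path_min (leT := fun u w => (u \in A) == (w \in A))) => // u w z /eqP-> .
have hE u : u \in A :|: B -> (u \in A) = (h \in A).
  by move/sp; rewrite inE => /predU1P[->//|/(allP all_h)/eqP->].
by move: (hE a) (hE b); rewrite !inE aA bB orbT (negbTE bA) => <- // /(_ isT).
Qed.

Lemma two_cliques_hforce : 5 <= #|V| -> hforce_number G (#|V| - 2).
Proof.
move=> V_ge5.
have cAB : #|A :|: B| = #|V| - 2.
  rewrite cardsU disjoint_setI0; last by case: GAB.
  by rewrite cards0 subn0 -card_cut addnK.
have sizeE (c : seq V) (D : {set V}) : uniq c -> (forall u, (u \in c) = (u \notin D)) ->
    size c + #|D| = #|V|.
  move=> /card_uniqP<- mem_c; rewrite addnC -(cardsC D); congr (_ + _).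
  by apply: eq_card => u; rewrite !inE mem_c.
have [c0 /andP[Ec0 Uc0] mem_c0] := two_cliques_omit (sub0set _).
have hamG : hamiltonian G.
  exists c0; split; last by move=> u; rewrite mem_c0 inE.
  split; first by apply/andP.
  by have := sizeE _ _ Uc0 mem_c0; rewrite cards0 addn0 => ->; apply: leq_trans V_ge5.
split=> //.
  exists (A :|: B) => //; split.
    by rewrite -card_gt0 cAB subn_gt0; apply: leq_trans V_ge5.
  by move=> c [cyc_c sub]; split=> //; apply: cycle_through_cliques.
move=> X hX; rewrite -cAB; apply/subset_leq_card/subsetP => w wAB.
have [c /andP[Ec Uc] mem_c] : exists2 c, cycle E c && uniq c
    & forall u, (u \in c) = (u \notin [set w]).
  by apply: two_cliques_omit; rewrite sub1set.
apply: hforce_mem hX (_ : is_cycle G c) _ _; last 2 first.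
- by move=> u; rewrite mem_c inE.
- by rewrite mem_c inE eqxx.
split; first by apply/andP.
have := sizeE _ _ Uc mem_c; rewrite cards1 addn1 => cE.
by rewrite -ltnS cE; apply: leq_trans V_ge5.
Qed.
End TwoCliques.

(** * H-force number of the graphs of phi_2 *)

Section SetJoin.
Variables (b : bool) (I : {set V}).
Hypothesis join_I : set_join b G I.

Lemma join_inE x y : x \in I -> E x y = (y \notin I).
Proof.
by move=> xI; rewrite join_I xI; case: eqP => // <-; rewrite xI.
Qed.

(** The path starts and ends outside [I], so that a further vertex of [I] closes it into a cycle. *)
Lemma alternating_path l1 l2 y : size l1 = size l2 ->
    {subset l1 <= I} -> {subset l2 <= ~: I} -> y \notin I ->
  exists c, [/\ perm_eq c (l1 ++ l2), path E y c & last y c \notin I].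
Proof.
elim: l1 l2 y => [|x l1 IH] [|z l2] y //=; first by exists [::].
move=> [eq_s] s1 s2 yI.
have xI : x \in I by rewrite s1 ?mem_head.
have zI : z \notin I by rewrite -in_setC s2 ?mem_head.
have [u ul|u ul|c [cP Ec lc]] := IH l2 z eq_s _ _ zI.
- by apply: s1; rewrite inE ul orbT.
- by apply: s2; rewrite inE ul orbT.
exists [:: x, z & c]; split=> //=.
  by rewrite perm_cons -(cat1s z l2) perm_sym perm_catCA /= perm_cons perm_sym.
by rewrite adj_sym !join_inE // yI zI.
Qed.

Lemma alternating_cycle l1 l2 : size l1 = size l2 -> uniq l1 -> uniq l2 ->
    {subset l1 <= I} -> {subset l2 <= ~: I} -> 1 < size l1 ->
  exists2 c, is_cycle G c & perm_eq c (l1 ++ l2).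
Proof.
case: l1 l2 => [|x l1] [|y l2] // [eq_s] U1 U2 s1 s2 l1_gt0.
have xI : x \in I by rewrite s1 ?mem_head.
have yI : y \notin I by rewrite -in_setC s2 ?mem_head.
have [u ul|u ul|c [cP Ec lc]] := @alternating_path l1 l2 y eq_s _ _ yI.
- by apply: s1; rewrite inE ul orbT.
- by apply: s2; rewrite inE ul orbT.
have pc : perm_eq [:: x, y & c] ((x :: l1) ++ y :: l2).
  by rewrite /= perm_cons -(cat1s y l2) perm_sym perm_catCA /= perm_cons perm_sym.
exists [:: x, y & c] => //; split.
  apply/andP; split.
    by rewrite /= rcons_path Ec join_inE // yI adj_sym join_inE.
  rewrite (perm_uniq pc) cat_uniq U1 U2 andbT andTb; apply/hasPn => u /s2.
  by rewrite in_setC; apply: contraNN => /s1.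
by rewrite (perm_size pc) size_cat /= addnS !ltnS -eq_s; move: l1_gt0 => /=; case: (size l1).
Qed.

Lemma set_join_hforce k : 2 < k -> #|I| = k -> #|~: I| = k -> hforce_number G k.
Proof.
move=> k_gt2 cI cIC.
have subI (D : {set V}) : {subset enum (I :\: D) <= I}.
  by move=> u; rewrite mem_enum inE => /andP[].
have subIC (D : {set V}) : {subset enum (~: I :\: D) <= ~: I}.
  by move=> u; rewrite mem_enum inE => /andP[].
split.
- have [||||||c cyc_c cP] := alternating_cycle (l1 := enum I) (l2 := enum (~: I)).
  + by rewrite -!cardE cI cIC.
  + exact: enum_uniq.
  + exact: enum_uniq.
  + by move=> u; rewrite mem_enum.
  + by move=> u; rewrite mem_enum.
  + by rewrite -cardE cI; apply: ltn_trans k_gt2.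
  exists c; split=> // u; rewrite (perm_mem cP) mem_cat !mem_enum in_setC.
  exact: orbN.
- exists I => //; split; first by rewrite -card_gt0 cI (ltn_trans _ k_gt2).
  move=> c [cyc_c sub]; split=> //; have [/andP[Ec Uc] _] := cyc_c.
  (* Since [I] is independent, the successors of its k vertices on [c] are k distinct vertices of
     the complement, hence all of it. *)
  have nextI : next c @: I = ~: I.
    apply/eqP; rewrite eqEcard (card_imset _ (can_inj (prev_next Uc))) cI cIC leqnn.
    rewrite andbT; apply/subsetP => z /imsetP[u uI ->]; rewrite in_setC.
    by rewrite -(join_inE _ uI) next_cycle ?sub.
  move=> u; case: (boolP (u \in I)) => [/sub //|]; rewrite -in_setC -nextI.
  by case/imsetP => z zI ->; rewrite mem_next sub.
(* A smaller [X] misses some [i] in [I] and some [j] outside. Dropping both keeps the sides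
   balanced, with k - 1 > 1 vertices each, so an alternating cycle covers the rest. *)
move=> X hX; rewrite leqNgt; apply/negP => ltX.
have missing (J : {set V}) : #|J| = k -> exists2 i, i \in J & i \notin X.
  move=> cJ; apply/subsetPn; apply: contraTN ltX => /subset_leq_card.
  by rewrite cJ -leqNgt.
have [i iI iX] := missing I cI; have [j jI jX] := missing _ cIC.
have sI : size (enum (I :\ i)) = k.-1 by rewrite -cardE -cI [in RHS](cardsD1 i) iI.
have sJ : size (enum (~: I :\ j)) = k.-1 by rewrite -cardE -cIC [in RHS](cardsD1 j) jI.
have [||||||c cyc_c cP] := alternating_cycle (l1 := enum (I :\ i)) (l2 := enum (~: I :\ j)).
- by rewrite sI sJ.
- exact: enum_uniq.
- exact: enum_uniq.
- exact: subI.
- exact: subIC.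
- by rewrite sI; move: k_gt2; case: (k) => [|[]].
have mem_c u : (u \in c) = (u != i) && (u \in I) || (u != j) && (u \in ~: I).
  by rewrite (perm_mem cP) mem_cat !mem_enum !in_setD1.
have [_ hamX] := hX; have [|_ /(_ i)] := hamX c; last first.
  by rewrite mem_c eqxx in_setC iI andbF.
split=> // u uX; rewrite mem_c in_setC.
have -> : u != i by apply: contraNneq iX => <-.
have -> : u != j by apply: contraNneq jX => <-.
exact: orbN.
Qed.

End SetJoin.

Lemma complete_cycle (D : {set V}) : (forall x y, x != y -> E x y) -> 2 < #|D| ->
  exists2 c, is_cycle G c & forall u, (u \in c) = (u \in D).
Proof.
move=> cl D_gt2; exists (enum D); last by move=> u; rewrite mem_enum.
split; last by rewrite -cardE.
apply/andP; split; last exact: enum_uniq.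
case: (enum D) (enum_uniq D) D_gt2 (cardE D) => [|x p] Us cD sD; first by rewrite sD in cD.
rewrite /= rcons_path clique_path //=; last by move=> u w _ _; apply: cl.
apply: cl; case/lastP: p Us sD cD => [|p y] Us sD cD; first by rewrite sD in cD.
rewrite last_rcons; apply: contraTneq Us => ->.
by rewrite /= mem_rcons mem_head.
Qed.

End HForce.

(** * Degrees and weak closures *)

Section Degrees.
Variables (V : finType) (G : sgraph V).
Notation E := (adj G).

Definition universal := [set x | deg G x == #|V|.-1].

Lemma in_universal x : (x \in universal) = [forall y, (y != x) ==> E x y].
Proof.
rewrite in_set; have cx : #|[set~ x]| = #|V|.-1 by rewrite cardsC1.
have sub : [set y | E x y] \subset [set~ x].
  by apply/subsetP => y; rewrite !inE; apply: contraTneq => ->; rewrite adj_irr.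
have := subset_leqif_cards sub; rewrite cx => -[_ ->].
apply/eqP/forallP => [/setP NE y | all_y].
  by have := NE y; rewrite !inE => ->; apply/implyP.
apply/setP => y; rewrite !inE; apply/idP/idP => [|yx]; last exact: (implyP (all_y y)).
by apply: contraTneq => ->; rewrite adj_irr.
Qed.

Lemma universalP x : reflect (forall y, y != x -> E x y) (x \in universal).
Proof.
by rewrite in_universal; apply: (iffP forallP) => H y; [apply/implyP | apply/implyP/H].
Qed.

Lemma not_universal x : x \notin universal -> exists2 y, y != x & ~~ E x y.
Proof.
rewrite in_universal negb_forall => /existsP[y]; rewrite negb_imply => /andP[yx nxy].
by exists y.
Qed.

Section TwoCliquesDegree.
Variables A B : {set V}.
Hypothesis GAB : two_cliques G A B.

Lemma two_cliques_sym : two_cliques G B A.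
Proof.
case: GAB => dis adjG; split=> [|x y]; first by rewrite disjoint_sym.
by rewrite adjG orbC.
Qed.

Lemma two_cliques_deg x : x \in A -> deg G x + #|B|.+1 = #|V|.
Proof.
case: GAB => dis adjG xA; have xB : x \notin B.
  by apply/negP => xB; have := pred0P dis x; rewrite /= xA xB.
rewrite -(cardsC (x |: B)) addnC cardsU1 xB; congr (_ + _).
by apply: eq_card => y; rewrite !inE adjG xA (negbTE xB) /= orbF negb_or eq_sym.
Qed.

Lemma two_cliques_universal : A != set0 -> B != set0 -> universal = ~: (A :|: B).
Proof.
case: GAB => dis adjG /set0Pn[a aA] /set0Pn[b bB].
have nAB u : u \in A -> u \notin B.
  by move=> uA; apply/negP => uB; have := pred0P dis u; rewrite /= uA uB.
apply/setP => x; rewrite in_setC in_setU; apply/universalP/norP => [xU|[xA xB] y yx].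
  split; apply/negP; [move=> xA | move=> xB].
    have bx : b != x by apply: contraNneq (nAB _ xA) => <-.
    by have := xU b bx; rewrite adjG xA bB andbF.
  have ax : a != x by apply: contraNneq (nAB _ aA) => ->.
  by have := xU a ax; rewrite adjG xB aA orbT andbF.
by rewrite adjG eq_sym yx (negbTE xA) (negbTE xB).
Qed.
End TwoCliquesDegree.

Lemma set_join_deg b I x : set_join b G I ->
  deg G x = if x \in I then #|~: I| else if b then #|V|.-1 else #|I|.
Proof.
move=> adjG; case: (boolP (x \in I)) => xI.
  apply: eq_card => y; rewrite !inE adjG xI; case: (x =P y) => [<-|] //.
  by rewrite xI.
case: b adjG => adjG; last first.
  apply: eq_card => y; rewrite !inE adjG (negbTE xI) orbF.
  by case: (x =P y) => [<-|] //; rewrite (negbTE xI).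
rewrite -(cardsC1 x); apply: eq_card => y.
by rewrite !inE adjG (negbTE xI) orbT andbT eq_sym.
Qed.

End Degrees.

Lemma OTG_weak_steps (V : finType) (G H : sgraph V) :
  OTG G -> weak_steps G H -> OTG H.
Proof.
move=> otgG; elim=> // G1 G2 _ IH [a [b [_ adjE]]] u v uv nuv.
have sub w : deg G1 w <= deg G2 w.
  by apply/subset_leq_card/subsetP => z; rewrite !inE adjE => ->.
apply: leq_trans (IH u v uv _) (leq_add (sub u) (sub v)).
by apply: contraNN nuv; rewrite adjE => ->.
Qed.

(** Adding edges preserves the lower bound n on degree sums of nonadjacent pairs, and the end of the
    closure process bounds them above by n. Conversely such a graph is its own weak closure. *)
Lemma CwP (V : finType) (G : sgraph V) n : Cw n G <->
  (#|V| = n /\ forall u v, u != v -> ~~ adj G u v -> deg G u + deg G v = n).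
Proof.
split=> [[cV [H otgH [stepsHG max_G]]]|[cV tight]]; split=> //.
  move=> u v uv nuv; apply/eqP; rewrite eqn_leq -{2}cV.
  rewrite (OTG_weak_steps otgH stepsHG) // andbT leqNgt; apply/negP => lt_n.
  by apply: (max_G u v); split=> //; rewrite addn1 cV.
exists G; first by move=> u v uv nuv; rewrite cV tight.
split; first exact: weak_steps0.
by move=> u v [uv nuv]; rewrite (tight u v uv nuv) cV addn1 ltnn.
Qed.

(** * Graphs whose non-universal vertices have degree n/2 *)

Section HalfRegular.
Variables (V : finType) (G : sgraph V) (k : nat).
Notation E := (adj G).

(* The graphs Z v K_m with all vertices of Z of degree k = n/2, where K_m is the set of universal vertices. *)
Definition half_regular := [/\ #|V| = 2 * k,
  forall x, deg G x = k \/ x \in universal G & #|universal G| < k].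

Hypothesis k_gt2 : 2 < k.
Hypothesis regG : half_regular.

Lemma half_regular_min x : k <= deg G x.
Proof.
case: regG => cV deg_k _; have [->//|] := deg_k x.
by rewrite in_set cV => /eqP->; move: k_gt2; clear; lia.
Qed.

Lemma half_regular_universal x : k < deg G x -> x \in universal G.
Proof.
by case: regG => _ deg_k _ lt_k; have [ek|//] := deg_k x; rewrite ek ltnn in lt_k.
Qed.

(** Each vertex of [I] has k neighbours among the k vertices outside, hence all of them. An edge
    inside the complement would give its ends degree above k, so make them universal, and then every
    vertex of the complement: k universal vertices, too many. *)
Lemma half_regular_bipartite (I : {set V}) : #|I| = k -> {in I &, forall x y, ~~ E x y} ->
  set_join false G I.
Proof.
have [cV _ ltU] := regG => cI indI.
have cIC : #|~: I| = k by apply/eqP; rewrite -(eqn_add2l k) -{1}cI cardsC cV mul2n addnn.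
have nbrI z : z \in I -> [set y | E z y] = ~: I.
  move=> zI; apply/eqP; rewrite eqEcard cIC half_regular_min andbT.
  apply/subsetP => y; rewrite in_set in_setC; apply: contraTN => yI; exact: indI.
have adjI z y : z \in I -> E z y = (y \notin I).
  by move=> zI; have /setP/(_ y) := nbrI z zI; rewrite !inE.
have big j : j \notin I -> (exists2 j', j' \notin I & E j j') -> j \in universal G.
  move=> jI [j' j'I jj']; apply: half_regular_universal.
  have sub : j' |: I \subset [set y | E j y].
    apply/subsetP => y; rewrite !inE => /predU1P[->//|yI].
    by rewrite adj_sym adjI.
  by have := subset_leq_card sub; rewrite cardsU1 j'I cI.
have indC : {in ~: I &, forall j j', ~~ E j j'}.
  move=> j j'; rewrite !in_setC => jI j'I; apply/negP => jj'.
  have jU : j \in universal G by apply: big => //; exists j'.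
  suff : ~: I \subset universal G by move/subset_leq_card; rewrite cIC leqNgt ltU.
  apply/subsetP => i; rewrite in_setC => iI; case: (i =P j) => [->//|/eqP ij].
  by apply: big => //; exists j; rewrite // adj_sym; apply: (universalP _ _ jU).
move=> x y; case: (boolP (x \in I)) => xI.
  by rewrite adjI //; case: eqP => // <-; rewrite xI.
rewrite orbF; case: (boolP (y \in I)) => yI.
  by rewrite adj_sym adjI // xI andbT; apply/esym; apply: contraNneq xI => ->.
by rewrite andbF; apply/negbTE/indC; rewrite in_setC.
Qed.

(** A vertex [z] of [A] needs k neighbours, and only k vertices lie outside [B] and differ from [z];
    so it is adjacent to all of these. Likewise for [B]. *)
Lemma half_regular_cliques (A B : {set V}) : [disjoint A & B] -> #|A| = k.-1 -> #|B| = k.-1 ->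
  {in A & B, forall x y, ~~ E x y} -> two_cliques G A B.
Proof.
have [cV _ ltU] := regG => dis cA cB nAB.
have nbr (P Q : {set V}) z : [disjoint P & Q] -> #|P| = k.-1 -> #|Q| = k.-1 ->
    {in P & Q, forall x y, ~~ E x y} -> z \in P -> [set y | E z y] = ~: (z |: Q).
  move=> disPQ cP cQ nPQ zP; have zQ : z \notin Q.
    by apply/negP => zQ; have := pred0P disPQ z; rewrite /= zP zQ.
  apply/eqP; rewrite eqEcard; apply/andP; split.
    apply/subsetP => y; rewrite !inE => zy; rewrite negb_or; apply/andP; split.
      by apply: contraTneq zy => ->; rewrite adj_irr.
    by apply: contraTN zy; apply: nPQ.
  have := cardsC (z |: Q); rewrite cardsU1 zQ cQ cV.
  by have := half_regular_min z; rewrite /deg; move: k_gt2; clear; lia.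
have nBA : {in B & A, forall x y, ~~ E x y}.
  by move=> x y xB yA; rewrite adj_sym nAB.
have adjA z y : z \in A -> E z y = (y != z) && (y \notin B).
  by move=> zA; have /setP/(_ y) := nbr A B z dis cA cB nAB zA; rewrite !inE negb_or.
have adjB z y : z \in B -> E z y = (y != z) && (y \notin A).
  rewrite disjoint_sym in dis.
  by move=> zB; have /setP/(_ y) := nbr B A z dis cB cA nBA zB; rewrite !inE negb_or.
have disAB z : (z \in A) && (z \in B) = false by apply: (pred0P dis).
split=> // x y; case: (boolP (x \in A)) => xA.
  by have := disAB x; rewrite xA /= => ->; rewrite orbF adjA // eq_sym.
case: (boolP (x \in B)) => xB; first by rewrite adjB // eq_sym.
rewrite andbT.
(* A vertex outside both sets has at least 2k - 2 neighbours, more than k because k > 2. *)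
have xU : x \in universal G.
  apply: half_regular_universal.
  have sub : A :|: B \subset [set y | E x y].
    apply/subsetP => z; rewrite !inE adj_sym => /orP[zA|zB].
      by rewrite adjA // xB andbT; apply: contraNneq xA => ->.
    by rewrite adjB // xA andbT; apply: contraNneq xB => ->.
  have := subset_leq_card sub; rewrite cardsU disjoint_setI0 // cards0 cA cB.
  by rewrite -/(deg G x); move: k_gt2; clear; lia.
by apply/idP/idP => [|xy]; [apply: contraTneq => ->; rewrite adj_irr
  | apply: (universalP _ _ xU); rewrite eq_sym].
Qed.

(** Every vertex-deleted subgraph is Hamiltonian: the two exceptions of [vertex_deletion] are turned
    by the preceding lemmas into the excluded structures. *)
Lemma half_regular_hforce :
    (forall I : {set V}, #|I| = k -> ~ set_join false G I) ->
    (forall A B : {set V}, #|A| = k.-1 -> #|B| = k.-1 -> ~ two_cliques G A B) ->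
  hforce_number G (2 * k).
Proof.
have [cV _ _] := regG => no_bip no_cl.
have [c0 c0P Ec0] : exists2 c, perm_eq c (enum V) & cycle E c.
  apply: dirac; first by rewrite cV; move: k_gt2; clear; lia.
  by move=> u; rewrite cV leq_mul2l half_regular_min.
have cycleI s c : uniq s -> 2 < size s -> perm_eq c s -> cycle E c -> is_cycle G c.
  move=> Us s_gt2 cs Ec; split; last by rewrite (perm_size cs).
  by apply/andP; rewrite (perm_uniq cs).
rewrite -cV; apply: hforce_number_full.
- by rewrite cV; move: k_gt2; clear; lia.
- exists c0; split; last by move=> u; rewrite (perm_mem c0P) mem_enum.
  apply: cycleI c0P Ec0; rewrite ?enum_uniq // -cardE cV; move: k_gt2; clear; lia.
move=> w.
have [[c cP Ec]|no_cycle] := spans_cycleP G (enum [set~ w]).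
  exists c; last by move=> u; rewrite (perm_mem cP) mem_enum !inE.
  apply: cycleI cP Ec; rewrite ?enum_uniq // -cardE cardsC1 cV.
  by move: k_gt2; clear; lia.
exfalso; have [c Uc mem_c|[I cI indI]|[A [B [dis cA cB nAB]]]] :=
    @vertex_deletion V G k w k_gt2 cV half_regular_min.
- apply: no_cycle; apply: uniq_perm; rewrite ?enum_uniq // => u.
  by rewrite mem_c mem_enum !inE.
- exact: no_bip (half_regular_bipartite cI indI).
exact: no_cl (half_regular_cliques dis cA cB nAB).
Qed.

End HalfRegular.

Lemma giso_complete (V : finType) (G : sgraph V) n :
  giso G (complete n) <-> #|V| = n /\ forall x y, x != y -> adj G x y.
Proof.
split=> [iso|[cV cl]].
  split; first by rewrite (giso_card iso) card_ord.
  by case: iso => f bij_f fE x y xy; rewrite fE /= /complete_adj (bij_eq bij_f).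
apply: (giso_blowup (T := unit) (M := fun _ _ => true) (f := fun=> tt) (g := fun=> tt)).
- move=> x y; rewrite andbT; apply/idP/idP => [|/cl//].
  by apply: contraTneq => ->; rewrite adj_irr.
- by move=> x y; rewrite andbT.
by case; rewrite !cardsE cV card_ord.
Qed.

(** The vertices of K_m are universal, while those of [Z] have degree k < 2k - 1; so at most m < k
    vertices are universal. *)
Lemma half_regular_of_join (V : finType) (G : sgraph V) k m p (Z : sgraph 'I_p) :
    2 < k -> p + m = 2 * k -> m < k -> (forall z, deg (gjoin Z (complete m)) (inl z) = k) ->
    giso G (gjoin Z (complete m)) -> half_regular G k.
Proof.
move=> k_gt2 pm lt_m degZ iso.
have cV : #|V| = 2 * k.
  by rewrite (giso_card iso) card_sum !card_ord.
case: iso => f bij_f fE; have degE := giso_deg bij_f fE.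
have univ_inr i x : f x = inr i -> x \in universal G.
  move=> fx; apply/universalP => y; rewrite fE fx -(bij_eq bij_f) fx.
  by case: (f y) => //= j; rewrite /complete_adj eq_sym.
split=> // [x|].
  case fx: (f x) => [z|i]; last by right; apply: univ_inr fx.
  by left; rewrite degE fx degZ.
have sub : universal G \subset f @^-1: [set y | if y is inr _ then true else false].
  apply/subsetP => x; rewrite !inE degE; case: (f x) => // z.
  by rewrite degZ cV; move: k_gt2; clear; lia.
apply: leq_ltn_trans (subset_leq_card sub) _; rewrite card_bij_preim //.
rewrite card_sumset eq_card0 => [|z]; last by rewrite !inE.
by rewrite card_full // => z; rewrite !inE.
Qed.

Lemma join_of_half_regular (V : finType) (G : sgraph V) k (m := #|universal G|) :
    2 < k -> half_regular G k ->
  exists Z : sgraph 'I_(2 * k - m),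
    (forall z, deg (gjoin Z (complete m)) (inl z) = k) /\
    giso G (gjoin Z (complete m)).
Proof.
move=> k_gt2 [cV deg_k ltU].
pose inr_b (y : 'I_(2 * k - m) + 'I_m) := if y is inr _ then true else false.
(* Colouring vertices by being universal or not sends the universal ones onto the K_m side. *)
have [h [h' hK h'K] hU] : exists2 h : V -> 'I_(2 * k - m) + 'I_m,
    bijective h & forall x, inr_b (h x) = (x \in universal G).
  apply: color_bij => b; rewrite card_sumset; case: b.
    rewrite [X in _ = X + _]eq_card0 => [|z]; last by rewrite !inE.
    rewrite card_full => [|z]; last by rewrite !inE.
    by apply: eq_card => x; rewrite !inE eqb_id.
  rewrite card_full => [|z]; last by rewrite !inE.
  rewrite [X in _ = _ + X]eq_card0 => [|z]; last by rewrite !inE.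
  rewrite addn0 -cV -(cardsC (universal G)) addKn.
  by apply: eq_card => x; rewrite !inE eqbF_neg.
have Zsym : symmetric (fun i j => adj G (h' (inl i)) (h' (inl j))).
  by move=> i j; rewrite adj_sym.
have Zirr : irreflexive (fun i j => adj G (h' (inl i)) (h' (inl j))).
  by move=> i; rewrite adj_irr.
have bij_h : bijective h by exists h'.
have hE x y : adj G x y = adj (gjoin (SGraph Zsym Zirr) (complete m)) (h x) (h y).
  have := hU x; have := hU y.
  case hx: (h x) => [i|i]; case hy: (h y) => [j|j] /=.
  - by rewrite -hx -hy !hK.
  - move=> /esym/universalP yU _; rewrite adj_sym; apply: yU.
    by rewrite -(bij_eq bij_h) hx hy.
  - move=> _ /esym/universalP; apply.
    by rewrite -(bij_eq bij_h) hx hy.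
  move=> _ /esym/universalP xU; have ijE : (i == j) = (x == y).
    by rewrite -(bij_eq bij_h) hx hy.
  rewrite /complete_adj ijE; apply/idP/idP => [|xy]; last by apply: xU; rewrite eq_sym.
  by apply: contraTneq => ->; rewrite adj_irr.
exists (SGraph Zsym Zirr); split; last by exists h.
move=> z; rewrite -[inl z]h'K -(giso_deg bij_h hE).
by have [//|] := deg_k (h' (inl z)); rewrite -hU h'K.
Qed.

Lemma phi3P n (V : finType) (G : sgraph V) : 5 <= n -> phi3 n G <->
  (exists k, [/\ n = 2 * k, half_regular G k,
     forall I : {set V}, #|I| = k -> ~ set_join false G I &
     forall A B : {set V}, #|A| = k.-1 -> #|B| = k.-1 -> ~ two_cliques G A B]) \/
  (#|V| = n /\ forall x y, x != y -> adj G x y).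
Proof.
move=> n_ge5; rewrite /phi3 giso_complete.
have card_std m p : #|{: 'I_2 + ('I_m + 'I_p)}| = 2 + (m + p).
  by rewrite !card_sum !card_ord.
split=> -[H|]; [left| by right |left |by right].
  case: H => even_n [m [Z [lt_m degZ iso]]] nG12 nK.
  have nE : n = 2 * n./2 by rewrite mul2n even_halfK.
  (* An even n that is at least 5 is at least 6. *)
  have k_gt2 : 2 < n./2 by move: n_ge5 nE; clear; lia.
  have regG : half_regular G n./2.
    apply: half_regular_of_join k_gt2 _ _ degZ iso.
      by rewrite -nE subnK //; move: lt_m; clear; lia.
    by move: lt_m nE; clear; lia.
  have [cV _ _] := regG.
  exists n./2; split=> // [I cI joinI|A B cA cB tcG].
    apply: nK; have [_ [J joinJ cJ]] := set_join_std n./2 n./2.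
    apply: set_join_giso joinI joinJ _ _; last by rewrite cI cJ.
    by rewrite card_sum !card_ord addnn -mul2n.
  apply: nG12; have [C [D [tcD cC cD]]] := two_cliques_std (n./2 - 1) (n./2 - 1).
  apply: two_cliques_giso tcG tcD _ _ _; rewrite ?cC ?cD ?subn1 //.
  by rewrite card_std cV; move: k_gt2; clear; lia.
case: H => k [nE regG no_bip no_cl].
have kE : n./2 = k by rewrite nE mul2n doubleK.
have k_gt2 : 2 < k by move: n_ge5 nE; clear; lia.
have [cV _ ltU] := regG.
split.
- by rewrite nE oddM.
- have [Z [degZ iso]] := join_of_half_regular k_gt2 regG.
  rewrite kE nE; exists #|universal G|, Z; split=> //.
  by rewrite ltn_mul2l.
- move=> iso; have [C [D [tcD cC cD]]] := two_cliques_std (n./2 - 1) (n./2 - 1).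
  have [A [B [tcG cA cB]]] := two_cliques_transport iso tcD.
  by apply: no_cl tcG; rewrite ?cA ?cB ?cC ?cD kE subn1.
move=> iso; have [_ [J joinJ cJ]] := set_join_std n./2 n./2.
have [I joinI cI] := set_join_transport iso joinJ.
by apply: no_bip joinI; rewrite cI cJ.
Qed.

(** * Classification *)

Section Classification.
Variables (V : finType) (G : sgraph V) (n : nat).
Notation E := (adj G).
Hypothesis n_ge5 : 5 <= n.
Hypothesis cardV : #|V| = n.
Hypothesis tight : forall u v, u != v -> ~~ E u v -> deg G u + deg G v = n.

(** * A vertex of degree below n/2 forces phi_1 *)

Section LowVertex.
Variable u0 : V.
Hypothesis low_u0 : 2 * deg G u0 < n.

Let L := [set x | 2 * deg G x < n].

Lemma low_clique : {in L &, forall x y, x != y -> E x y}.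
Proof.
move=> x y; rewrite !in_set => lx ly xy; apply: contraT => /(tight xy).
by move: lx ly; clear; lia.
Qed.

(** A vertex of degree n/2 is adjacent to every vertex of another degree. So with [M] the set of
    degree n/2, [x] sees all of its complement and [u0] all of [M], whence n is at most d(x) + d(u0)
    < n. *)
Lemma no_half_degree x : 2 * deg G x != n.
Proof.
apply/eqP => half_x; pose M := [set y | 2 * deg G y == n].
have adjM y z : y \in M -> z \notin M -> E y z.
  rewrite !in_set => /eqP hy hz; apply: contraT => /(tight _) t.
  have /t : y != z by apply: contraNneq hz => <-; apply/eqP.
  by move: hy hz => <- /eqP; clear; lia.
have u0M : u0 \notin M by rewrite in_set; apply: contraTneq low_u0 => ->; rewrite ltnn.
have xM : x \in M by rewrite in_set half_x.
have sub_x : ~: M \subset [set y | E x y].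
  by apply/subsetP => y; rewrite in_setC in_set; apply: adjM.
have sub_u : M \subset [set y | E u0 y].
  by apply/subsetP => y yM; rewrite in_set adj_sym adjM.
have := subset_leq_card sub_x; have := subset_leq_card sub_u.
rewrite -/(deg G x) -/(deg G u0); have := cardsC M; rewrite cardV.
by move: low_u0 half_x; clear; lia.
Qed.

Lemma high_clique : {in ~: L &, forall x y, x != y -> E x y}.
Proof.
move=> x y; rewrite !in_setC !in_set -!leqNgt => hx hy xy; apply: contraT => /(tight xy).
by move: hx hy (no_half_degree x) (no_half_degree y); clear; lia.
Qed.

(* clique_deg turns d(x) + d(y) = n into el x + eh y = 2 for nonadjacent x, y. *)
Let el x := #|[set y in ~: L | E x y]|.
Let eh y := #|[set x in L | E x y]|.

Lemma clique_deg (P : {set V}) x : {in P &, forall y z, y != z -> E y z} -> x \in P ->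
  (deg G x).+1 = #|P| + #|[set y in ~: P | E x y]|.
Proof.
move=> cl xP; rewrite (cardsD1 x P) xP add1n addSn; congr _.+1.
rewrite /deg -(cardsID P); congr (_ + _); apply: eq_card => y; rewrite !inE.
  case: (y =P x) => [->|/eqP yx] /=; first by rewrite adj_irr.
  by case: (boolP (y \in P)) => yP; rewrite ?andbF // cl // eq_sym.
by rewrite andbC.
Qed.

Lemma cross_degrees x y : x \in L -> y \notin L -> ~~ E x y -> el x + eh y = 2.
Proof.
move=> xL yL nxy.
have xy : x != y by apply: contraNneq yL => <-.
have dx := clique_deg low_clique xL.
have yH : y \in ~: L by rewrite in_setC.
have dy := clique_deg high_clique yH.
have -> : eh y = #|[set x in ~: ~: L | E y x]|.
  by apply: eq_card => z; rewrite !inE negbK adj_sym.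
have := tight xy nxy; have := cardsC L; rewrite cardV /el.
by move: dx dy; clear; lia.
Qed.

Lemma low_nonadjacent x : x \in L -> exists2 y, y \notin L & ~~ E x y.
Proof.
move=> xL; have [|y yx nxy] := @not_universal _ G x.
  rewrite in_set cardV; move: xL; rewrite in_set; apply: contraTneq => ->.
  by rewrite -leqNgt; move: n_ge5; clear; lia.
exists y => //; apply: contraNN nxy => yL; apply: low_clique => //.
by rewrite eq_sym.
Qed.

Lemma eh_low x y : x \in L -> E x y -> 0 < eh y.
Proof. by move=> xL xy; apply/card_gt0P; exists x; rewrite in_set xL. Qed.

Lemma el_high x y : y \notin L -> E x y -> 0 < el x.
Proof. by move=> yL xy; apply/card_gt0P; exists y; rewrite in_set in_setC yL. Qed.

(** If [x] has no neighbour outside [L], every [y] outside has [eh y] = 2. Then some [z] in [L] has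
    a neighbour outside, but any non-neighbour [w] of [z] outside has [eh w] = 2 and forces [el z] =
    0. *)
Lemma el_neq0 x : x \in L -> el x != 0.
Proof.
move=> xL; apply/eqP => el0.
have nx y : y \notin L -> ~~ E x y.
  by move=> yL; apply: contra_eqN el0 => xy; rewrite -lt0n (el_high yL).
have eh2 y : y \notin L -> eh y = 2.
  by move=> yL; have := cross_degrees xL yL (nx y yL); rewrite el0.
have [y yL _] := low_nonadjacent xL.
have /card_gt0P[z] : 0 < eh y by rewrite eh2.
rewrite in_set => /andP[zL zy]; have [w wL nzw] := low_nonadjacent zL.
have := cross_degrees zL wL nzw; rewrite eh2 //.
by have := el_high yL zy; clear; lia.
Qed.

Lemma sum_cross : \sum_(x in L) el x = \sum_(y in ~: L) eh y.
Proof.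
have -> : \sum_(x in L) el x = \sum_(x in L) \sum_(y in ~: L) E x y.
  by apply: eq_bigr => x _; rewrite /el -sum1dep_card big_mkcondr.
rewrite exchange_big; apply: eq_bigr => y _.
by rewrite /eh -sum1dep_card big_mkcondr.
Qed.

(** Otherwise [el] is 1 on all of [L] and [eh] is at least 1 outside. Counting the cross edges
    twice, the complement of [L] is no larger than [L]; but [L] has d(u0) < n/2 elements. *)
Lemma el_two : exists2 x, x \in L & el x = 2.
Proof.
case: (boolP [exists x in L, el x == 2]) => [/exists_inP[x xL /eqP elx]|].
  by exists x.
move=> /exists_inPn no2; exfalso.
have u0L : u0 \in L by rewrite in_set.
have el1 x : x \in L -> el x = 1.
  move=> xL; have [y yL nxy] := low_nonadjacent xL.
  have := cross_degrees xL yL nxy; have := el_neq0 xL; have := no2 x xL.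
  by clear; lia.
have eh1 y : y \in ~: L -> 1 <= eh y.
  rewrite in_setC => yL; case: (boolP (E u0 y)) => [/(eh_low u0L)//|nuy].
  by have := cross_degrees u0L yL nuy; rewrite el1 // add1n => -[->].
have le_HL : #|~: L| <= #|L|.
  apply: (@leq_trans (\sum_(y in ~: L) eh y)).
    by rewrite -sum1_card; apply: leq_sum.
  by rewrite -sum_cross -sum1_card; apply: leq_sum => x /el1->.
have := clique_deg low_clique u0L; rewrite -/(el u0) el1 //.
by move: (cardsC L) le_HL low_u0; rewrite cardV; clear; lia.
Qed.

(** A non-neighbour [v] of [u] outside [L] has [eh v] = 0, so [el] is 2 on all of [L]. Vertices
    outside [L] then see none of [L] or all of it, and the latter are the two cross neighbours of
    [u]. *)
Lemma low_vertex_phi1 : phi1 n G.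
Proof.
have [u uL eu2] := el_two.
have [v vL nuv] := low_nonadjacent uL.
have ehv : eh v = 0 by have := cross_degrees uL vL nuv; rewrite eu2; clear; lia.
have nv x : x \in L -> ~~ E x v.
  by move=> xL; apply: contra_eqN ehv => xv; rewrite -lt0n (eh_low xL).
have el2 x : x \in L -> el x = 2.
  by move=> xL; have := cross_degrees xL vL (nv x xL); rewrite ehv addn0.
pose B := [set y in ~: L | ~~ E u y].
have inB y : (y \in B) = (y \notin L) && ~~ E u y.
  by rewrite [LHS]in_set in_setC.
have nLB x y : x \in L -> y \in B -> ~~ E x y.
  rewrite inB => xL /andP[yL nuy].
  have ehy : eh y = 0 by have := cross_degrees uL yL nuy; rewrite eu2; clear; lia.
  by apply: contra_eqN ehy => xy; rewrite -lt0n (eh_low xL).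
have adjLC x y : x \in L -> y \notin L -> y \notin B -> E x y.
  move=> xL yL; rewrite inB yL /= negbK => uy; apply: contraT => nxy.
  have := cross_degrees xL yL nxy; rewrite el2 //.
  by have := eh_low uL uy; clear; lia.
have cB : #|L| + #|B| + 2 = n.
  rewrite -cardV -(cardsC L) -addnA -eu2; congr (_ + _).
  rewrite -(cardsID [set y | E u y] (~: L)) addnC; congr (_ + _).
    by apply: eq_card => y; rewrite !inE.
  by apply: eq_card => y; rewrite !inE andbC.
apply/phi1P; split=> //; exists L, B; split=> //.
- split.
    by apply/pred0P => x /=; rewrite inB; case: (x \in L).
  move=> x y; case: (x =P y) => [->|/eqP xy] /=; first by rewrite adj_irr.
  case: (boolP (x \in L)) => xL; case: (boolP (y \in L)) => yL.
  - have nB z : z \in L -> (z \in B) = false by rewrite inB => ->.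
    by rewrite !nB //= low_clique.
  - rewrite andbF orbF /=; case: (boolP (y \in B)) => yB; first exact/negbTE/nLB.
    exact: adjLC.
  - rewrite andbT /= adj_sym; case: (boolP (x \in B)) => xB; first exact/negbTE/nLB.
    exact: adjLC.
  by rewrite andbF /=; apply: high_clique; rewrite ?in_setC.
- by apply/card_gt0P; exists u.
have := clique_deg low_clique uL; rewrite -/(el u) eu2.
by move: uL; rewrite in_set; clear; lia.
Qed.

End LowVertex.

Lemma tight_classification : phi1 n G \/ phi2 n G \/ phi3 n G.
Proof.
case: (boolP [exists u, 2 * deg G u < n]) => [/existsP[u lu]|].
  by left; apply: low_vertex_phi1 lu.
rewrite negb_exists => /forallP no_low.
have half u v : u != v -> ~~ E u v -> 2 * deg G u = n.
  move=> uv nuv; have := tight uv nuv; have := no_low u; have := no_low v.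
  by clear; lia.
case: (boolP [forall u, u \in universal G]) => [/forallP all_univ|].
  right; right; apply/phi3P => //; right; split=> // x y xy.
  by apply: (universalP _ _ (all_univ x)); rewrite eq_sym.
rewrite negb_forall => /existsP[u /[dup] uU /not_universal[v vu nuv]].
pose k := deg G u.
have nE : n = 2 * k by rewrite (half u v) // eq_sym.
have k_gt2 : 2 < k by move: n_ge5 nE; clear; lia.
have deg_k x : x \notin universal G -> deg G x = k.
  move=> /not_universal[y yx nxy]; have := half x y; rewrite eq_sym => /(_ yx nxy).
  by rewrite nE; clear; lia.
have subU x : universal G \subset [set y | E x y] :|: [set x].
  apply/subsetP => y yU; rewrite !inE; case: (y =P x) => [->|/eqP yx]; first by rewrite orbT.
  by rewrite orbF adj_sym; apply: (universalP _ _ yU); rewrite eq_sym.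
have subU' x : x \notin universal G -> universal G \subset [set y | E x y].
  move=> xU; apply/subsetP => y yU; have := subsetP (subU x) y yU.
  by rewrite !inE => /orP[//|/eqP yx]; rewrite yx (negbTE xU) in yU.
have leU : #|universal G| <= k by apply: subset_leq_card (subU' u uU).
(* If there are k universal vertices, they are the whole neighbourhood of each other vertex, and the
   graph is G_21. *)
move: leU; rewrite leq_eqVlt => /predU1P[eqU|ltU].
  right; left; apply/phi2P; split=> //; exists true, (~: universal G); split; last first.
    by have := cardsC (universal G); rewrite cardV eqU nE; clear; lia.
  have nbr x y : x \notin universal G -> E x y = (y \in universal G).
    move=> xU; have /setP/(_ y) : universal G = [set y | E x y].
      by apply/eqP; rewrite eqEcard subU' //= -/(deg G x) deg_k // eqU.
    by rewrite [RHS]in_set => ->.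
  move=> x y; rewrite !in_setC negbK; case: (boolP (x \in universal G)) => xU /=.
    rewrite orbT andbT; apply/idP/idP => [|xy]; last first.
      by apply: (universalP _ _ xU); rewrite eq_sym.
    by apply: contraTneq => ->; rewrite adj_irr.
  rewrite nbr //; case: (x =P y) => [<-|//]; exact: negbTE.
have regG : half_regular G k.
  split=> // [|x]; first by rewrite cardV nE.
  by case: (boolP (x \in universal G)) => xU; [right | left; apply: deg_k].
case: (classic (exists I : {set V}, #|I| = k /\ set_join false G I)) => [[I [cI joinI]]|no_bip].
  by right; left; apply/phi2P; split=> //; exists false, I; rewrite cI nE.
(* This is G_12, the member of phi_1 with m = k - 1. *)
case: (classic (exists A B : {set V}, [/\ #|A| = k.-1, #|B| = k.-1 & two_cliques G A B])).
  case=> A [B [cA cB tcG]]; left; apply/phi1P; split=> //; exists A, B.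
  by split=> //; move: cA cB nE k_gt2; clear; lia.
move=> no_cl; right; right; apply/phi3P => //; left; exists k.
split=> // [I cI joinI|A B cA cB tcG].
  by apply: no_bip; exists I.
by apply: no_cl; exists A, B.
Qed.

End Classification.

(** * Disjointness of the families and their H-force numbers *)

Section Invariants.
Variables (V : finType) (G : sgraph V) (n : nat).
Hypothesis n_ge5 : 5 <= n.

(** The number of universal vertices tells families apart: 2 here, n/2 or 0 in phi_2, n for the
    complete graph. *)
Lemma phi1_universal : phi1 n G -> #|universal G| = 2.
Proof.
case/phi1P=> cV [A [B [tcG A_gt0 ltA sAB]]].
have B_gt0 : 0 < #|B| by move: sAB ltA n_ge5; clear; lia.
rewrite (two_cliques_universal tcG) -?card_gt0 //.
have := cardsC (A :|: B); rewrite cV cardsU disjoint_setI0; last by case: tcG.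
by rewrite cards0; move: sAB; clear; lia.
Qed.

Lemma set_join_universal b I : set_join b G I -> 2 * #|I| = n -> #|V| = n ->
  #|universal G| = if b then #|I| else 0.
Proof.
move=> joinI cI cV; have cIC := cardsC I; rewrite cV in cIC.
have degE x := set_join_deg x joinI.
case: b joinI degE => joinI degE.
  have -> : universal G = ~: I.
    apply/setP => x; rewrite in_set in_setC degE; case: (x \in I); last exact: eqxx.
    by apply/negbTE; move: cI cIC n_ge5; rewrite cV; clear; lia.
  by move: cI cIC; clear; lia.
apply: eq_card0 => x; rewrite in_set degE cV.
by apply/negbTE; case: (x \in I); move: cI cIC n_ge5; clear; lia.
Qed.

Lemma complete_universal : (forall x y, x != y -> adj G x y) -> #|universal G| = #|V|.
Proof.
move=> cl; rewrite -cardsT; apply: eq_card => x; rewrite in_setT.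
by apply/universalP => y yx; apply: cl; rewrite eq_sym.
Qed.

Lemma phi1_phi2 : phi1 n G -> phi2 n G -> False.
Proof.
move=> /phi1_universal U2 /phi2P[cV [b [I [joinI cI]]]].
have := set_join_universal joinI cI cV; rewrite U2.
by case: b {joinI}; move: n_ge5 cI; clear; lia.
Qed.

(** In the half-regular case a vertex of [A] is not universal, so it has degree k; then both cliques
    have k - 1 vertices, which is the excluded G_12. *)
Lemma phi1_phi3 : phi1 n G -> phi3 n G -> False.
Proof.
move=> ph1 /(phi3P _ n_ge5)[[k [nE regG _ no_cl]]|[cV cl]]; last first.
  by have := complete_universal cl; rewrite (phi1_universal ph1) cV; move: n_ge5; clear; lia.
have /phi1P[cV [A [B [tcG A_gt0 ltA sAB]]]] := ph1.
have [a aA] : exists a, a \in A by apply/card_gt0P.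
have := two_cliques_deg tcG aA; have [_ deg_k _] := regG.
have [->|] := deg_k a.
  rewrite cV nE => cB; apply: no_cl tcG; move: cB sAB; rewrite nE; clear; lia.
by rewrite in_set => /eqP->; move: cV sAB ltA A_gt0 n_ge5; clear; lia.
Qed.

Lemma phi2_phi3 : phi2 n G -> phi3 n G -> False.
Proof.
move=> /phi2P[cV [b [I [joinI cI]]]].
have := set_join_universal joinI cI cV.
move=> cU /(phi3P _ n_ge5)[[k [nE [_ _ ltU] no_bip _]]|[_ /complete_universal]].
  have cIk : #|I| = k by move: cI nE; clear; lia.
  case: b joinI cU => joinI cU; last exact: no_bip joinI.
  by move: ltU; rewrite cU cIk ltnn.
by rewrite cU cV; case: b {joinI cU}; move: cI n_ge5; clear; lia.
Qed.

Lemma phi1_hforce : phi1 n G -> hforce_number G (n - 2).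
Proof.
case/phi1P=> cV [A [B [tcG A_gt0 ltA sAB]]]; rewrite -cV.
apply: (two_cliques_hforce tcG); rewrite ?cV //.
by move: ltA sAB n_ge5; clear; lia.
Qed.

Lemma phi2_hforce : phi2 n G -> exists2 k, hforce_number G k & 2 * k = n.
Proof.
case/phi2P=> cV [b [I [joinI cI]]]; exists #|I| => //.
apply: (set_join_hforce joinI) => //; first by move: cI n_ge5; clear; lia.
by have := cardsC I; rewrite cV; move: cI; clear; lia.
Qed.

Lemma phi3_hforce : phi3 n G -> hforce_number G n.
Proof.
case/(phi3P _ n_ge5)=> [[k [nE regG no_bip no_cl]]|[cV cl]].
  by rewrite nE; apply: half_regular_hforce => //; move: nE n_ge5; clear; lia.
rewrite -cV; apply: hforce_number_full; first by rewrite cV; case: (n) n_ge5.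
  have [|c cyc_c mem_c] := complete_cycle (D := [set: V]) cl.
    by rewrite cardsT cV; apply: leq_trans n_ge5.
  by exists c; split=> // x; rewrite mem_c inE.
move=> w; have [|c cyc_c mem_c] := complete_cycle (D := [set~ w]) cl.
  by rewrite cardsC1 cV; move: n_ge5; clear; lia.
by exists c => // x; rewrite mem_c !inE.
Qed.

(** By [CwP] only degree sums matter. In phi_1 a nonadjacent pair lies across [A] and [B], with
    degrees n - 1 - |B| and n - 1 - |A|; in the other families both degrees are n/2. *)
Lemma phi_Cw : phi1 n G \/ phi2 n G \/ phi3 n G -> Cw n G.
Proof.
move=> phiG; apply/CwP; case: phiG => [/phi1P|[/phi2P|/(phi3P _ n_ge5)]].
- case=> cV [A [B [tcG _ _ sAB]]]; split=> // u v uv.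
  have tcG' := two_cliques_sym tcG; have [_ adjG] := tcG.
  rewrite adjG uv negbK => /orP[]/andP[uP vP].
    have := two_cliques_deg tcG uP; have := two_cliques_deg tcG' vP.
    by move: cV sAB; clear; lia.
  have := two_cliques_deg tcG' uP; have := two_cliques_deg tcG vP.
  by move: cV sAB; clear; lia.
- case=> cV [b [I [joinI cI]]]; split=> // u v uv.
  have cIC := cardsC I; rewrite joinI uv !(set_join_deg _ joinI).
  case: (u \in I); case: (v \in I) => //=.
    by move=> _; move: cI cIC cV; clear; lia.
  by case: b {joinI} => //= _; move: cI; clear; lia.
case=> [[k [nE [cV deg_k _] _ _]]|[cV cl]]; split=> //; first by rewrite nE.
  move=> u v uv nuv; have [->|/universalP uU] := deg_k u; last first.
    by move: nuv; rewrite uU // eq_sym.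
  have [->|/universalP vU] := deg_k v; first by rewrite nE mul2n addnn.
  by move: nuv; rewrite adj_sym vU.
by move=> u v uv; rewrite cl.
Qed.

End Invariants.

Theorem theorem3p1 (n : nat) (n_ge5 : 5 <= n) :
  (forall (V : finType) (G : sgraph V),
     Cw n G <-> phi1 n G \/ phi2 n G \/ phi3 n G) /\
  (forall (V : finType) (G : sgraph V),
     [/\ ~ (phi1 n G /\ phi2 n G), ~ (phi1 n G /\ phi3 n G)
       & ~ (phi2 n G /\ phi3 n G)]) /\
  (forall (V : finType) (Gw : sgraph V), Cw n Gw ->
     [/\ hforce_number Gw (n - 2) <-> phi1 n Gw,
         (exists2 k, hforce_number Gw k & 2 * k = n) <-> phi2 n Gw
       & hforce_number Gw n <-> phi3 n Gw]).
Proof.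
have classify (V : finType) (G : sgraph V) : Cw n G -> phi1 n G \/ phi2 n G \/ phi3 n G.
  by case/CwP=> cV tight; apply: tight_classification.
split; first by move=> V G; split; [apply: classify | apply: phi_Cw].
split=> [V G|V G /classify phiG].
  by split; case; [apply: phi1_phi2 | apply: phi1_phi3 | apply: phi2_phi3].
(* The converse implications hold because h is single-valued and n - 2, n/2 and n are distinct for n
   >= 5. *)
have h_eq k l : k != l -> hforce_number G k -> hforce_number G l -> False.
  by move=> /eqP kl hk hl; apply: kl; apply: hforce_number_inj hk hl.
have n2_n : n - 2 != n by move: n_ge5; clear; lia.
have half_n k : 2 * k = n -> k != n by move: n_ge5; clear; lia.
have half_n2 k : 2 * k = n -> k != n - 2 by move: n_ge5; clear; lia.
have h1 := @phi1_hforce V G n n_ge5; have h2 := @phi2_hforce V G n n_ge5.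
have h3 := @phi3_hforce V G n n_ge5.
split; split=> //.
- move=> h; case: phiG => [//|[/h2[k hk kn]|/h3 hn]]; exfalso.
    exact: h_eq (half_n2 k kn) hk h.
  exact: h_eq n2_n h hn.
- case=> k hk kn; case: phiG => [/h1 hn|[//|/h3 hn]]; exfalso.
    exact: h_eq (half_n2 k kn) hk hn.
  exact: h_eq (half_n k kn) hk hn.
move=> h; case: phiG => [/h1 hn|[/h2[k hk kn]|//]]; exfalso.
  exact: h_eq n2_n hn h.
exact: h_eq (half_n k kn) hk h.
Qed.
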